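(* For every orientation $K$ of the complete graph $K_4$ (i.e., every tournament on $4$ vertices), we have $\text{mader}_{\vec{\chi}}(K)=4$.
   Context: Digraphs are finite, have a nonempty vertex set, are loopless and have no parallel arcs, but may contain anti-parallel pairs of arcs $(x,y),(y,x)$ (digons). An orientation of a simple undirected graph $G$ is any digraph obtained by replacing each edge $\{u,v\}$ by exactly one of the arcs $(u,v),(v,u)$. An acyclic $k$-coloring of $D$ is a map $c:V(D)\to\{1,\dots,k\}$ such that each color class $c^{-1}(i)$ induces an acyclic subdigraph (one with no directed cycle; a digon is a directed cycle of length 2). The dichromatic number $\vec{\chi}(D)$ is the smallest $k\in\mathbb{N}$ for which $D$ has an acyclic $k$-coloring. A subdivision of a digraph $F$ is any digraph obtained by replacing every arc $(x,y)$ of $F$ by a directed path from $x$ to $y$ (of length at least 1), where the subdivision paths of different arcs are internally vertex-disjoint (and their internal vertices are new vertices). A digraph $D$ contains a subdivision of $F$ if some subdigraph of $D$ is isomorphic to a subdivision of $F$. $\text{mader}_{\vec{\chi}}(F)$ denotes the smallest integer $k\ge 1$ such that every digraph $D$ with $\vec{\chi}(D)\ge k$ contains a subdivision of $F$ (it is known that such a $k$ exists for every digraph $F$). *)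

(* Defs.v *)
From mathcomp Require Import all_boot.
From mathcomp Require Import boolp.

Set Implicit Arguments.
Unset Strict Implicit.
Unset Printing Implicit Defensive.

(* Returns the junk value 0 when no natural number satisfies P. *)
Definition least (P : nat -> Prop) : nat :=
  match pselect (exists n, `[< P n >]) with
  | left exP => ex_minn exP
  | right _ => 0
  end.

Lemma leastP (P : nat -> Prop) : (exists n, P n) ->
  P (least P) /\ (forall n, P n -> least P <= n).
Proof.
move=> [n Pn]; rewrite /least; case: pselect => [exP | []]; last first.
  by exists n; apply/asboolP.
case: ex_minnP => m /asboolP Pm min_m; split=> // p Pp.
by apply: min_m; apply/asboolP.
Qed.

Record digraph := Digraph {
  vertex :> finType;
  arc : rel vertex;
  arc_irr : irreflexive arc;
  vertex_gt0 : 0 < #|vertex| }.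

Definition diso (G H : digraph) : Prop :=
  exists f : G -> H, bijective f /\ forall x y, arc (f x) (f y) = arc x y.

Record subdigraph (D : digraph) := Subdigraph {
  sub_vertex : {set D};
  sub_arc : rel D;
  sub_arcP : forall x y, sub_arc x y ->
    [/\ x \in sub_vertex, y \in sub_vertex & arc x y];
  sub_vertex_gt0 : 0 < #|sub_vertex| }.

Section SubdigraphAsDigraph.
Variables (D : digraph) (S : subdigraph D).

Definition subdigraph_arc : rel {x : D | x \in sub_vertex S} :=
  fun x y => sub_arc S (val x) (val y).

Lemma subdigraph_arc_irr : irreflexive subdigraph_arc.
Proof.
move=> x; apply/negP => /sub_arcP [_ _].
by rewrite arc_irr.
Qed.

Lemma subdigraph_gt0 : 0 < #|{: {x : D | x \in sub_vertex S}}|.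
Proof. by rewrite card_sig sub_vertex_gt0. Qed.

Definition digraph_of_subdigraph : digraph :=
  Digraph subdigraph_arc_irr subdigraph_gt0.

End SubdigraphAsDigraph.

Coercion digraph_of_subdigraph : subdigraph >-> digraph.

(* Looplessness excludes cycles of length 1; a digon [:: x; y] is a cycle. *)
Definition acyclic_on (D : digraph) (A : {set D}) : Prop :=
  forall p : seq D, {subset p <= A} -> ucycle (@arc D) p -> p = [::].

Definition acyclic_coloring (D : digraph) (k : nat) (c : D -> 'I_k) : Prop :=
  forall i : 'I_k, acyclic_on (c @^-1: [set i]).

Definition acyclic_colorable (D : digraph) (k : nat) : Prop :=
  exists c : D -> 'I_k, acyclic_coloring c.

Lemma acyclic_colorable_card (D : digraph) : acyclic_colorable D #|D|.
Proof.
exists enum_rank => i [//|x [|y p]] sub_p /andP[].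
  by rewrite /= arc_irr.
have Ex z : z \in [:: x, y & p] -> z = enum_val i.
  by move=> /sub_p; rewrite !inE => /eqP <-; rewrite enum_rankK.
have xy : x = y.
  by apply: etrans (Ex x _) (esym (Ex y _)); rewrite !inE eqxx ?orbT.
by rewrite xy /= inE eqxx.
Qed.

Definition dichromatic (D : digraph) : nat := least (acyclic_colorable D).

Section Subdivision.
Variables (F : digraph) (l : {a : F * F | arc a.1 a.2} -> nat).

(* The arc a = (x, y) is replaced by the path
     inl x, inr (a, 0), ..., inr (a, l a - 1), inl y
   of length l a + 1. *)
Definition subdiv_vertex : finType :=
  (F + {a : {a : F * F | arc a.1 a.2} & 'I_(l a)})%type.

Definition subdiv_arc : rel subdiv_vertex := fun u v =>
  match u, v with
  | inl x, inl y => [exists a, (val a == (x, y)) && (l a == 0)]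
  | inl x, inr w => ((val (tag w)).1 == x) && (tagged w == 0 :> nat)
  | inr w, inl y => ((val (tag w)).2 == y) && ((tagged w).+1 == l (tag w))
  | inr w, inr z => (tag w == tag z) && (tagged z == (tagged w).+1 :> nat)
  end.

Lemma subdiv_arc_irr : irreflexive subdiv_arc.
Proof.
case=> [x | w] /=; last by rewrite eqxx ltn_eqF.
apply/existsP => -[[a Fa] /= /andP[/eqP Ea _]].
by move: Fa; rewrite Ea arc_irr.
Qed.

Lemma subdiv_gt0 : 0 < #|subdiv_vertex|.
Proof. by rewrite card_sum addn_gt0 vertex_gt0. Qed.

Definition subdivision : digraph := Digraph subdiv_arc_irr subdiv_gt0.

End Subdivision.

Definition contains_subdivision (D F : digraph) : Prop :=
  exists (l : {a : F * F | arc a.1 a.2} -> nat) (S : subdigraph D),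
    diso S (subdivision l).

(* Since 1 <= k is required, the value 0 occurs only if no such k exists. *)
Definition mader (F : digraph) : nat :=
  least (fun k => 1 <= k /\
    forall D : digraph, k <= dichromatic D -> contains_subdivision D F).

Definition is_orientation (D : digraph) (g : rel D) : Prop :=
  forall x y : D,
    g x y = (arc x y || arc y x) /\ ~~ (arc x y && arc y x).

Definition complete_rel (T : eqType) : rel T := fun x y => x != y.

(* Main.v *)
(* Let D be 4-dichromatic; the three shapes below yield the four tournaments.

   Contraction.  Let N be a set of vertices entered only from a vertex z, and
   add to D - N an arc z -> y for every path from z through N to y.  A colouring
   of D - N with these arcs has no monochromatic path from such a y back to z,
   so it combines with any colouring of the subdigraph induced by z and N.
   Hence a minimal counterexample has all in- and out-degrees at least 3 and no
   proper vertex set entered from fewer than two vertices, provided that the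
   shape found lifts back along the contraction.

   Wheels (the tournament C_3 => sink and, by reversal, source => C_3).  Choose
   Y0 minimal among the sets with at most two in-neighbours, say s and t.  There
   is a directed cycle through Y0, s and a second vertex outside Y0 which misses
   some w in Y0.  If two vertices separated this cycle from w, uncrossing the
   resulting cut with Y0 would contradict minimality or 2-connectivity.

   Transitive tournament.  It is a triple of internally disjoint a-w paths two
   of which are joined by a path avoiding a and w.  Choose Y minimal among the
   sets with at most two in-neighbours or at most two out-neighbours; then any
   two vertices a, w of Y work, again by uncrossing.  For the lifting, the
   induction also requires that the source (or the sink) avoids a given vertex.

   Strong tournament.  In a strongly connected D, take a wheel with cycle C and
   sink w, and a path from w back to C that ends at u.  Of the three vertices of
   C linked to w choose two other than u: the cycle C, a C-path from one of
   them to u near w, and a path from the other one to that C-path suffice.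

   The bound is sharp since the complete digraph on three vertices has
   dichromatic number 3 and fewer vertices than any subdivision of K. *)
Require Import Defs.
From mathcomp Require Import all_boot perm.
From mathcomp Require Import boolp zify.

Set Implicit Arguments.
Unset Strict Implicit.
Unset Printing Implicit Defensive.

(** * Restricted relations and in-neighbourhoods *)

Section Basics.
Variable T : finType.
Implicit Types (e r : rel T) (A B N Y S : {set T}) (x y z : T).

Definition conv e : rel T := fun x y => e y x.

Definition restr A e : rel T := fun x y => [&& x \in A, y \in A & e x y].

Definition in_nbrs A e Y : {set T} :=
  [set x in A :\: Y | [exists y in Y, e x y]].

Lemma in_nbrsP A e Y x :
  reflect [/\ x \in A, x \notin Y & exists2 y, y \in Y & e x y]
          (x \in in_nbrs A e Y).
Proof.
rewrite inE [x \in A :\: Y]inE; apply: (iffP andP).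
  by case=> /andP[nY Ax] /exists_inP[y Yy exy]; split=> //; exists y.
case=> Ax nY [y Yy exy]; split; first exact/andP.
by apply/exists_inP; exists y.
Qed.

(** Submodularity of the in-boundary, on which every uncrossing rests. An in-neighbour of the
    intersection or of the union is one of [Y1] or of [Y2], and a common one lies outside both sets
    and has an arc into both. *)
Lemma in_nbrs_submod A e Y1 Y2 :
  #|in_nbrs A e (Y1 :&: Y2)| + #|in_nbrs A e (Y1 :|: Y2)| <=
  #|in_nbrs A e Y1| + #|in_nbrs A e Y2|.
Proof.
rewrite -cardsUI -[leqRHS]cardsUI; apply: leq_add; apply/subset_leq_card/subsetP.
  move=> x; rewrite inE => /orP[] /in_nbrsP[Ax]; rewrite inE.
    rewrite negb_and => /orP[] nY [y /setIP[y1 y2] exy]; apply/setUP;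
    [left|right]; apply/in_nbrsP; split=> //; by exists y.
  rewrite negb_or => /andP[n1 n2] [y /setUP[] yY exy]; apply/setUP;
  [left|right]; apply/in_nbrsP; split=> //; by exists y.
move=> x /setIP[/in_nbrsP[_ _ [y /setIP[y1 y2] exy]] /in_nbrsP[Ax]].
by rewrite inE negb_or => /andP[n1 n2] _; apply/setIP;
  split; apply/in_nbrsP; split=> //; exists y.
Qed.

Lemma restr_sub A B e : A \subset B -> subrel (restr A e) (restr B e).
Proof. by move=> /subsetP sAB x y /and3P[/sAB Bx /sAB By exy]; apply/and3P. Qed.

Lemma connect_restr_sub A B e :
  A \subset B -> subrel (connect (restr A e)) (connect (restr B e)).
Proof.
by move=> sAB; apply: connect_sub => x y /(restr_sub sAB); apply: connect1.
Qed.

Lemma path_restr A e x p :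
  path (restr A e) x p -> path e x p /\ {subset p <= A}.
Proof.
elim: p x => [|y p IH] x //= /andP[/and3P[Ax Ay exy] /IH[-> sp]].
by rewrite exy; split=> // z; rewrite inE => /orP[/eqP->|/sp].
Qed.

Lemma path_restrI A e x p :
  x \in A -> {subset p <= A} -> path e x p -> path (restr A e) x p.
Proof.
elim: p x => [|y p IH] x //= Ax sp /andP[exy ep].
have Ay : y \in A by apply: sp; rewrite mem_head.
rewrite /restr Ax Ay exy /=; apply: IH => // z zp.
by apply: sp; rewrite inE zp orbT.
Qed.

Lemma connect_conv e x y : connect (conv e) x y = connect e y x.
Proof.
apply/connectP/connectP => -[p ep ->].
  exists (rev (belast x p)); first by rewrite rev_path.
  by case: p ep => //= z p _; rewrite rev_cons last_rcons.
exists (rev (belast y p)); first by rewrite rev_path.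
by case: p ep => //= z p _; rewrite rev_cons last_rcons.
Qed.

Lemma connect_cross r Y x y :
  connect r x y -> x \notin Y -> y \in Y ->
  exists u v, [/\ r u v, u \notin Y, v \in Y & connect r x u].
Proof.
case/connectP=> p; elim: p x => [|v p IH] x /=; first by move=> _ -> /negPf->.
case/andP=> rxv rp Ey nx Yy; have [Yv|nv] := boolP (v \in Y).
  by exists x, v.
have [u [v' [ruv nu Yv' c]]] := IH v rp Ey nv Yy.
by exists u, v'; split=> //; apply: connect_trans c; apply: connect1.
Qed.

Lemma first_hit r S x y :
  connect r x y -> y \in S ->
  exists p, [/\ path r x p, uniq (x :: p), last x p \in S &
                {in belast x p, forall u, u \notin S}].
Proof.
case/connectP=> p0 /shortenP[p rp up _] -> {p0} Sy.
suff [q [rq uq _ lq nq]] : exists q, [/\ path r x q, uniq (x :: q),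
    {subset q <= p}, last x q \in S & {in belast x q, forall u, u \notin S}].
  by exists q.
elim: p x rp up Sy => [|v p IH] x /=; first by exists [::].
case/andP=> rxv rp /andP[nxp up] lp.
have [Sx|nSx] := boolP (x \in S); first by exists [::].
have [q [rq uq sq lq nq]] := IH v rp up lp.
exists (v :: q); split=> //=; first by rewrite rxv.
- move: (uq) => /= ->; rewrite andbT; apply: contra nxp.
  by rewrite !inE => /orP[->//|/sq->]; rewrite orbT.
- by move=> u; rewrite !inE => /orP[->//|/sq->]; rewrite orbT.
- by move=> u; rewrite inE => /orP[/eqP->|/nq].
Qed.

End Basics.

(** * Acyclic 3-colourings *)

Section Coloring.
Variable T : finType.
Implicit Types (e r : rel T) (A B N Y S : {set T}) (x y z : T).

(* Acyclicity of the colour classes is witnessed by a rank function f that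
   increases along monochromatic arcs. *)
Definition colorable A e : Prop :=
  exists (c : T -> 'I_3) (f : T -> nat), forall x y,
    x \in A -> y \in A -> e x y -> c x = c y -> f x < f y.

Lemma colorable_sub A B e : A \subset B -> colorable B e -> colorable A e.
Proof.
move=> /subsetP sAB [c [f cf]]; exists c, f => x y /sAB Bx /sAB By.
exact: cf.
Qed.

Lemma colorable_conv A e : colorable A e -> colorable A (conv e).
Proof.
case=> c [f cf]; exists c, (fun x => (\max_y f y) - f x) => x y Ax Ay eyx cxy.
have := cf y x Ay Ax eyx (esym cxy).
have := leq_bigmax (F := f) x; have := leq_bigmax (F := f) y; lia.
Qed.

Definition via e N x y := [exists u in N, exists v in N,
  [&& e x u, connect (restr N e) u v & e v y]].

(** The contraction of [N] into [z], to be read on [A :\: N]. The clause [y != z] keeps it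
    loopless. *)
Definition short e N z : rel T :=
  fun x y => e x y || [&& x == z, y != z & via e N z y].

Lemma short_irr e N z : irreflexive e -> irreflexive (short e N z).
Proof. by move=> ie x; rewrite /short ie /=; case: eqP => //= ->; rewrite eqxx. Qed.

(** A monochromatic cycle that meets [N] but is not contained in [z |: N] would enter [N] from [z]
    and leave it to some [y]; the new arc [z -> y] turns it into a monochromatic cycle of [A :\: N].
    The ranks below make this explicit. *)
Lemma glue A N e z :
  N \subset A -> z \in A :\: N -> in_nbrs A e N \subset [set z] ->
  colorable (z |: N) e -> colorable (A :\: N) (short e N z) ->
  colorable A e.
Proof.
move=> /subsetP sNA /setDP[Az nNz] /subsetP Nz [c1 [f1 cf1]] [c2 [f2 cf2]].
(* Renaming the colours on [N] by this transposition makes the two colourings agree at [z]. *)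
pose p := tperm (c1 z) (c2 z).
pose c x := if x \in N then p (c1 x) else c2 x.
pose R x := [exists u in N, e z u && connect (restr N e) u x].
pose K := (\max_y f1 y).+1.
have ltK x : f1 x < K by rewrite ltnS (leq_bigmax (F := f1)).
pose N1 x := [&& c1 x == c1 z, f1 z < f1 x & R x].
(* Outside [N] the ranks are positive multiples of [K], which exceeds every [f1]. Vertices of [N]
   lie below all of these, except those of the colour of [z] that are reached from [z] and exceed it
   in [f1]: they go between [z] and the next multiple. *)
pose f x := if x \in N then if N1 x then (f2 z).+1 * K + f1 x else f1 x
            else (f2 x).+1 * K.
have mulK m n : m < n -> m.+1 * K + K <= n.+1 * K.
  by move=> mn; rewrite -[X in _ + X <= _]mul1n -mulnDl leq_mul2r; apply/orP; right; lia.
exists c, f => x y Ax Ay exy; rewrite /c /f.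
have zN : z \in z |: N by rewrite !inE eqxx.
have NzN u : u \in N -> u \in z |: N by move=> Nu; rewrite !inE Nu orbT.
have pz u : (p (c1 u) == c2 z) = (c1 u == c1 z).
  by rewrite -[c2 z](tpermL (c1 z)) (inj_eq perm_inj).
have inM u : u \in A -> u \notin N -> u \in A :\: N by move=> Au Nu; apply/setDP.
case: ifPn => Nx; case: ifPn => Ny cxy.
- have {}cxy : c1 x = c1 y by apply: perm_inj cxy.
  have lt := cf1 x y (NzN _ Nx) (NzN _ Ny) exy cxy.
  case: ifPn => [/and3P[cx fx /exists_inP[u Nu /andP[ezu cux]]] | _]; last first.
    by case: ifP => _; lia.
  rewrite ifT; first by lia.
  apply/and3P; split; [by rewrite -cxy | lia |].
  apply/exists_inP; exists u => //; rewrite ezu /=.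
  by apply: connect_trans cux _; apply: connect1; apply/and3P.
- case: ifPn => [/and3P[cx fx /exists_inP[u Nu /andP[ezu cux]]] | _]; last first.
    by have := ltK x; rewrite mulSn; lia.
  have cy : c2 y = c2 z by rewrite -cxy; apply/eqP; rewrite pz.
  have [Eyz|nyz] := eqVneq y z.
    rewrite Eyz in exy.
    by have := ltn_trans fx (cf1 x z (NzN _ Nx) zN exy (eqP cx)); rewrite ltnn.
  have : f2 z < f2 y.
    apply: cf2; rewrite ?inM // /short eqxx nyz /=.
    apply/orP; right; apply/exists_inP; exists u => //.
    by apply/exists_inP; exists x => //; apply/and3P.
  by move/mulK; have := ltK x; lia.
- have Exz : x = z.
    apply/set1P/Nz/in_nbrsP; split=> //; by exists y.
  have cy : c1 y = c1 z.
    by apply/eqP; rewrite -pz -cxy Exz.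
  rewrite Exz in exy.
  have lt : f1 z < f1 y := cf1 z y zN (NzN _ Ny) exy (esym cy).
  rewrite ifT; first by rewrite Exz; lia.
  apply/and3P; split=> //; first exact/eqP.
  by apply/exists_inP; exists y => //; rewrite exy connect0.
- have lt : f2 x < f2 y by apply: cf2; rewrite ?inM // /short exy.
  have := mulK _ _ lt; rewrite /K; lia.
Qed.

Definition critical A e :=
  ~ colorable A e /\ forall v, v \in A -> colorable (A :\ v) e.

Lemma critical_conv A e : critical A e -> critical A (conv e).
Proof.
by case=> nA cA; split=> [/colorable_conv//|v /cA /colorable_conv].
Qed.

Lemma critical_proper A B e : critical A e -> B \proper A -> colorable B e.
Proof.
case=> _ cA /properP[sBA [v Av nBv]]; apply: colorable_sub (cA v Av).
by rewrite subsetD1 sBA.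
Qed.

(** With at most two in-neighbours, some colour is missing among them. Given to [v], it leaves no
    monochromatic arc into [v], so [v] can take the lowest rank. *)
Lemma critical_deg A e v :
  irreflexive e -> critical A e -> v \in A -> 2 < #|in_nbrs A e [set v]|.
Proof.
move=> ie [nA cA] Av; rewrite ltnNge; apply/negP => le2; apply: nA.
have [c [f cf]] := cA v Av.
have [i ni] : exists i, i \notin c @: in_nbrs A e [set v].
  apply/existsP; rewrite -negb_forall; apply/negP => /forallP all.
  suff : 3 <= #|c @: in_nbrs A e [set v]|.
    by move/leq_trans/(_ (leq_imset_card _ _))/leq_trans/(_ le2).
  rewrite -{1}(card_ord 3) -cardsT; apply: subset_leq_card.
  by apply/subsetP => i _; apply: all.
exists (fun x => if x == v then i else c x),
       (fun x => if x == v then 0 else (f x).+1) => x y Ax Ay exy.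
case: eqVneq => [Ex|nx]; case: eqVneq => [Ey|ny] //.
- by move: exy; rewrite Ex Ey ie.
- move=> ci; case/negP: ni; rewrite -ci; apply/imset_f/in_nbrsP.
  by rewrite inE; split=> //; exists v; rewrite ?inE -?Ey.
- by move=> cc; rewrite ltnS; apply: cf; rewrite // !inE ?nx ?ny.
Qed.

(** Two vertices outside [N] make [z |: N] a proper subset of [A], hence colourable, and [glue]
    applies. *)
Lemma critical_glue A N e z : critical A e -> N \subset A -> z \in A :\: N ->
  1 < #|A :\: N| -> in_nbrs A e N \subset [set z] ->
  ~ colorable (A :\: N) (short e N z).
Proof.
move=> crA sNA AzN gt1 Nz; have nA := crA.1.
move=> cM; apply: nA; apply: (glue sNA AzN Nz _ cM).
apply: critical_proper crA _; have /setDP[Az nNz] := AzN.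
rewrite properE subUset sub1set Az sNA /=.
apply: contraL gt1 => sub; rewrite -leqNgt -(cards1 z); apply: subset_leq_card.
by apply/subsetP => u /setDP[/(subsetP sub)/setU1P[->|->//]]; rewrite inE.
Qed.

(** Strong 2-connectivity in terms of cuts; the size condition leaves room for two in-neighbours
    outside [N]. *)
Definition biconn A e := forall N, N \subset A -> N != set0 ->
  1 < #|A :\: N| -> 1 < #|in_nbrs A e N|.

Lemma biconn_conv A e : biconn A e -> biconn A (conv e).
Proof.
move=> bA U sUA nU0 gt1; rewrite ltnNge; apply/negP => le1.
have [v AUv Iv] : exists2 v, v \in A :\: U & in_nbrs A (conv e) U \subset [set v].
  have [I0|[v Iv]] := set_0Vmem (in_nbrs A (conv e) U).
    have /card_gt0P[v AUv] := ltnW gt1.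
    by exists v; rewrite // I0 sub0set.
  exists v; first by have /in_nbrsP[Av nUv _] := Iv; apply/setDP.
  by have /eqP-> : [set v] == in_nbrs A (conv e) U by rewrite eqEcard sub1set Iv cards1.
have /setDP[Av nUv] := AUv.
have [u Uu] := set0Pn _ nU0.
(* Since [U] has no out-neighbour other than [v], this set is entered only from [v]. *)
pose N := A :\: (v |: U).
have nN0 : N != set0.
  apply: contraL gt1 => /eqP N0; rewrite -leqNgt -(cards1 v).
  apply/subset_leq_card/subsetP => x /setDP[Ax nUx]; rewrite inE.
  by apply: contraT => nI; have := in_set0 x; rewrite -N0 !inE negb_or nUx nI Ax.
have gt1N : 1 < #|A :\: N|.
  apply: (@leq_trans #|[set u; v]|).
    by rewrite cards2; case: eqVneq => // E; rewrite -E Uu in nUv.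
  apply/subset_leq_card/subsetP => x; rewrite !inE => /orP[]/eqP->.
    by rewrite Uu orbT (subsetP sUA).
  by rewrite Av eqxx.
have := bA N (subsetDl _ _) nN0 gt1N.
rewrite ltnNge -(cards1 v) => /negP; apply; apply/subset_leq_card/subsetP.
move=> x /in_nbrsP[Ax nNx [y /setDP[Ay]]].
rewrite in_setU1 negb_or => /andP[nyv nUy] exy.
move: nNx; rewrite !(inE, Ax) andbT negbK => /orP[//|Ux].
case/negP: nyv; rewrite -in_set1; apply: (subsetP Iv); apply/in_nbrsP.
by split=> //; exists x.
Qed.

End Coloring.

(** * The theorems of Hall and Menger *)

(** As long as some set has two elements, one of them can be deleted without violating Hall's
    condition. Once all sets are singletons, the condition on pairs makes their elements
    distinct. *)
Lemma hall (L R : finType) (F : L -> {set R}) :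
  (forall I : {set L}, #|I| <= #|\bigcup_(i in I) F i|) ->
  exists f : L -> R, injective f /\ forall i, f i \in F i.
Proof.
have [n] := ubnP (\sum_i #|F i|); elim: n F => // n IH F ltn hF.
have [/existsP[i gt1] | /existsPn le1] := boolP [exists i, 1 < #|F i|].
  have [x [y [Fx Fy nxy]]] : exists x y, [/\ x \in F i, y \in F i & x != y].
    by have /card_gt1P[x [y]] := gt1; exists x, y.
  pose G z j := if j == i then F i :\ z else F j.
  have sumG z : z \in F i -> \sum_j #|G z j| < n.
    move=> Fz; rewrite (leq_trans _ (_ : (\sum_j #|F j|) <= n)) //.
    rewrite [ltnLHS](bigD1 i) //= [ltnRHS](bigD1 i) //= {1}/G eqxx.
    rewrite (eq_bigr (fun j => #|F j|)); last by move=> j /negPf; rewrite /G => ->.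
    by rewrite ltn_add2r [ltnRHS](cardsD1 z) Fz.
  have subG z j : G z j \subset F j.
    by rewrite /G; case: eqP => // ->; apply: subsetDl.
  have step z : z \in F i ->
      (exists f : L -> R, injective f /\ forall j, f j \in F j) \/
      exists I : {set L}, i \in I /\ #|\bigcup_(j in I) G z j| < #|I|.
    move=> Fz.
    have [/forallP hG|/forallPn[I]] :=
      boolP [forall I : {set L}, #|I| <= #|\bigcup_(j in I) G z j|].
      have [f [injf fG]] := IH (G z) (sumG z Fz) hG.
      by left; exists f; split=> // j; apply: (subsetP (subG z j)).
    rewrite -ltnNge => ltI; right; exists I; split=> //.
    apply: contraLR ltI => niI; rewrite -leqNgt.
    rewrite (eq_bigr F) // => j Ij; rewrite /G; case: eqP => // E.
    by rewrite -E Ij in niI.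
  (* Rado's argument: if neither x nor y can be deleted from F i, the two
     violating sets contradict submodularity. *)
  have [//|[I [iI ltI]]] := step x Fx.
  have [//|[J [iJ ltJ]]] := step y Fy.
  exfalso; set U := \bigcup_(j in I) _ in ltI; set V := \bigcup_(j in J) _ in ltJ.
  have sub1 : \bigcup_(j in I :|: J) F j \subset U :|: V.
    apply/bigcupsP => j; have [->|nji] := eqVneq j i.
      move=> _; apply/subsetP => z Fz; have [Ez|nz] := eqVneq z x; apply/setUP.
        right; apply/bigcupP; exists i => //.
        by rewrite /G eqxx !inE Fz Ez nxy.
      by left; apply/bigcupP; exists i => //; rewrite /G eqxx !inE Fz nz.
    case/setUP=> Hj; apply/subsetP => z Fz; apply/setUP; [left|right];
      by apply/bigcupP; exists j; rewrite // /G (negPf nji).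
  have sub2 : \bigcup_(j in (I :&: J) :\ i) F j \subset U :&: V.
    apply/bigcupsP => j /setD1P[nji /setIP[Ij Jj]]; apply/subsetP => z Fz.
    by apply/setIP; split; apply/bigcupP; exists j; rewrite // /G (negPf nji).
  have := leq_trans (hF _) (subset_leq_card sub1).
  have := leq_trans (hF _) (subset_leq_card sub2).
  have := cardsUI U V; have := cardsUI I J.
  have : #|I :&: J| = (#|(I :&: J) :\ i|).+1.
    by rewrite (cardsD1 i) inE iI iJ.
  lia.
have F1 i : exists x, F i == [set x].
  have /cards1P[x Fx] : #|F i| == 1; last by exists x; rewrite Fx.
  by rewrite eqn_leq leqNgt le1 /=; have := hF [set i]; rewrite cards1 big_set1.
pose f i := xchoose (F1 i).
have Ff i : F i = [set f i] by apply/eqP/(xchooseP (F1 i)).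
exists f; split=> [i j Ef|i]; last by rewrite Ff inE.
apply/eqP; apply: contraT => nij; have := hF [set i; j].
rewrite cards2 nij bigcup_setU !big_set1 !Ff Ef setUid cards1; lia.
Qed.

Section Menger.
Variables (T : finType) (r : rel T) (X Y : {set T}) (k : nat).

Hypothesis sep : forall S : {set T},
  (forall x y, x \in X :\: S -> y \in Y :\: S -> ~~ connect (restr (~: S) r) x y) ->
  k <= #|S|.

(* A matching that saturates L encodes k disjoint paths: an inner vertex u is
   matched to its successor, or to itself if it is unused; the k sources in L
   are matched into X, and the k sinks in R are matched to elements of Y. *)
Let L := ('I_k + T)%type.
Let R := (T + 'I_k)%type.

Let adj (l : L) (m : R) : bool :=
  match l, m with
  | inl _, inl x => x \in X
  | inl _, inr _ => false
  | inr u, inl v => (u == v) || r u v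
  | inr u, inr _ => u \in Y
  end.

(** Hall's condition for a set [I] with a source: if an inner vertex of [I] lies in [Y], all [k]
    sinks are neighbours; otherwise [NA :\: IA] separates [X] from [Y] and so has at least [k]
    elements. *)
Let matching : exists f : L -> R, injective f /\ forall l, adj l (f l).
Proof.
have [I|f [injf fP]] := @hall L R (fun l => [set m | adj l m]); last first.
  by exists f; split=> // l; have := fP l; rewrite inE.
set N := \bigcup_(i in I) _.
have NP l m : l \in I -> adj l m -> m \in N.
  by move=> Il a; apply/bigcupP; exists l; rewrite ?inE.
pose IA := [set u | inr u \in I]; pose IS := [set i | inl i \in I].
pose NA := [set u | inl u \in N]; pose NS := [set i | inr i \in N].
have -> : #|I| = #|IS| + #|IA| by rewrite -sum1_card big_sumType !sum1dep_card.
have -> : #|N| = #|NA| + #|NS| by rewrite -sum1_card big_sumType !sum1dep_card.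
have sIN : IA \subset NA.
  by apply/subsetP => u; rewrite !inE => Iu; apply: NP Iu _; rewrite /= eqxx.
have leS : #|IS| <= k by rewrite -[leqRHS]card_ord max_card.
have [-> | [i]] := set_0Vmem IS.
  by rewrite cards0 add0n; apply: leq_trans (leq_addr _ _); apply: subset_leq_card.
rewrite inE => Ii; have [disj|[u]] := set_0Vmem (IA :&: Y); last first.
  case/setIP; rewrite inE => Iu Yu.
  have -> : NS = setT by apply/setP => j; rewrite !inE; apply: NP Iu _.
  by rewrite cardsT card_ord; have := subset_leq_card sIN; lia.
have := @sep (NA :\: IA); rewrite cardsD (setIidPr sIN) => le_k.
suff /le_k : forall x y, x \in X :\: (NA :\: IA) -> y \in Y :\: (NA :\: IA) ->
    ~~ connect (restr (~: (NA :\: IA)) r) x y.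
  by have := subset_leq_card sIN; lia.
(* A path from [X] that avoids the separator starts in [IA] and must leave it, but the head of the
   leaving arc lies in [NA :\: IA]. *)
move=> x y /setDP[Xx nSx] /setDP[Yy _]; apply/negP => /connect_cross.
case/(_ (~: IA)).
- rewrite in_setC negbK; apply: contraR nSx => nIx; rewrite in_setD nIx inE.
  exact: NP Ii _.
- by rewrite in_setC; apply/negP => Iy; have := in_set0 y; rewrite -disj inE Iy Yy.
move=> u [v [/and3P[_ nSv ruv]]]; rewrite in_setC negbK inE => Iu.
rewrite in_setC => nIv _; move: nSv; rewrite in_setC in_setD nIv inE /= => /negP; apply.
by apply: NP Iu _; rewrite /= ruv orbT.
Qed.

Lemma menger : exists ps : 'I_k -> seq T,
  [/\ forall i, exists x q, [/\ ps i = x :: q, x \in X, last x q \in Y & path r x q],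
      forall i, uniq (ps i) &
      forall i j u, u \in ps i -> u \in ps j -> i = j].
Proof.
have [f [injf fP]] := matching.
(* Identifying the sinks with the sources makes the matching a permutation h;
   the paths are the pieces of its cycles between two sources. *)
pose swap (m : R) : L := match m with inl u => inr u | inr j => inl j end.
have injs : injective swap by move=> [u|u] [v|v] //= [->].
pose h l := swap (f l).
have injh : injective h by move=> l l' /injs/injf.
have injit n : injective (iter n h).
  by elim: n => // n IHn l l' /= /injh/IHn.
pose out (l : L) := if l is inl _ then true else false.
(* The orbit of a source comes back to a source; [n i] will be the number of inner vertices before
   the first return. *)
have exn i : exists n, out (iter n.+1 h (inl i)).
  by exists (order h (inl i)).-1; rewrite prednK ?order_gt0 // iter_order.
pose n i := ex_minn (exn i).
have nP i : out (iter (n i).+1 h (inl i)) by rewrite /n; case: ex_minnP.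
have nmin i m : m < n i -> exists u, iter m.+1 h (inl i) = inr u.
  rewrite /n; case: ex_minnP => n0 _ min ltm.
  case E: (iter m.+1 h (inl i)) => [j|u]; last by exists u.
  by have := min m; rewrite E leqNgt ltm => /(_ isT).
have start i : exists2 x, h (inl i) = inr x & x \in X.
  have := fP (inl i); rewrite /h /=; case: (f _) => // x Xx.
  by exists x.
have n_gt0 i : 0 < n i.
  rewrite lt0n; apply/eqP => n0; have := nP i; rewrite n0 /=.
  by have [x ->] := start i.
have inj_start i j m m' : m <= m' -> m' < n j ->
    iter m.+1 h (inl i) = iter m'.+1 h (inl j) -> m = m' /\ i = j.
  move=> lemm ltm'; rewrite -(subnKC lemm) -addSn iterD => /injit.
  case E: (m' - m) => [|d]; first by case=> ->; rewrite addn0.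
  have [|u ->] // := nmin j d; lia.
have ex_p i : exists p, [/\ exists x q, [/\ p = x :: q, x \in X, last x q \in Y & path r x q],
      uniq p & forall u, u \in p -> exists2 m, m < n i & iter m.+1 h (inl i) = inr u].
  have [x hx Xx] := start i.
  pose pr (l : L) := if l is inr u then u else x.
  pose g m := pr (iter m.+1 h (inl i)).
  have gP m : m < n i -> iter m.+1 h (inl i) = inr (g m).
    by move=> /nmin[u Eu]; rewrite /g Eu.
  exists (mkseq g (n i)); split.
  - exists x, (mkseq (fun m => g m.+1) (n i).-1).
    have Ex : g 0 = x by rewrite /g /= hx.
    have Eq : mkseq g (n i) = x :: mkseq (fun m => g m.+1) (n i).-1.
      by rewrite -{1}(prednK (n_gt0 i)) /mkseq /= Ex -[1]addn0 iotaDl -map_comp.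
    split=> //.
      have -> : last x (mkseq (fun m => g m.+1) (n i).-1) = g (n i).-1.
        rewrite (last_nth x) -Eq nth_mkseq size_mkseq //.
        by rewrite prednK ?n_gt0.
      have := gP (n i).-1; rewrite prednK ?n_gt0 // leqnn => /(_ isT) En.
      have := nP i; rewrite iterS En /h; have := fP (inr (g (n i).-1)).
      by case: (f _).
    apply/(pathP x) => m; rewrite size_mkseq => ltm; rewrite -Eq.
    rewrite !nth_mkseq //; last by lia.
    have := gP m.+1; have := gP m; rewrite (iterS m.+1) => ->; last by lia.
    rewrite /h; have := fP (inr (g m)); case Ef: (f _) => [v|j] /=; last first.
      by move=> _ /(_ _)/=; have lt : m.+1 < n i by [lia]; move/(_ lt).
    case/orP=> [/eqP Ev|rv]; last by have lt : m.+1 < n i by [lia]; move/(_ lt) => [<-].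
    (* A vertex matched to itself would be a fixed point of [h], and injectivity would carry this
       back to the source. *)
    have : iter m.+1 h (h (inl i)) = iter m.+1 h (inl i).
      by rewrite -iterSr iterS gP ?/h ?Ef -?Ev //; lia.
    by move/injit; rewrite hx.
  - apply/mkseq_uniqP => m m'; rewrite !inE => lt lt' Eg.
    have E : iter m.+1 h (inl i) = iter m'.+1 h (inl i) by rewrite !gP ?Eg.
    have [le|le] := leqP m m'; first by have [] := inj_start i i m m' le lt' E.
    by have [] := inj_start i i m' m (ltnW le) lt (esym E).
  - move=> u /mapP[m]; rewrite mem_iota add0n => /andP[_ ltm] ->.
    by exists m; rewrite ?gP.
have [ps psP] := fin_all_exists ex_p.
exists ps; split=> [i|i|i j u]; try by have [] := psP i.
have [_ _ Hi] := psP i; have [_ _ Hj] := psP j.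
case/Hi=> m ltm Em /Hj[m' ltm' Em'].
have [le|le] := leqP m m'.
  by have [] := inj_start i j m m' le ltm'; rewrite ?Em ?Em'.
by have [] := inj_start j i m' m (ltnW le) ltm; rewrite ?Em ?Em'.
Qed.

End Menger.

(** * Wheels *)

Section Wheel.
Variable T : finType.
Implicit Types (e r : rel T) (A B N Y S : {set T}) (x y z w : T) (C : seq T).

(** All new arcs leave [z], so at most one is used, and it is replaced by a simple path through [N].
    Leaving out the last vertex by [belast] lets the lemma serve paths and cycles alike. *)
Lemma lift_short e N z x p :
  path (short e N z) x p -> {in x :: p, forall u, u \notin N} ->
  uniq (belast x p) ->
  exists p', [/\ path e x p', last x p' = last x p, uniq (belast x p'),
    {subset belast x p <= belast x p'} &
    forall u, u \in belast x p' -> u \in belast x p \/ u \in N /\ z \in belast x p].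
Proof.
elim: p x => [|y q IH] x /=; first by exists [::]; split.
case/andP=> sxy sq nN /andP[nx uq].
have [|q' [eq' lq' uq' sub1 sub2]] := IH y sq _ uq.
  by move=> u yqu; apply: nN; rewrite inE yqu orbT.
have Nx : x \notin N by apply: nN; rewrite mem_head.
have nxq' : x \notin belast y q'.
  by apply/negP => /sub2[]; [apply/negP | case=> Nx'; rewrite Nx' in Nx].
case/orP: sxy => [exy|/and3P[/eqP Exz nyz /exists_inP[u Nu]]].
  exists (y :: q'); split=> //.
  - by rewrite /= exy.
  - by rewrite /= nxq'.
  - by move=> u /=; rewrite !inE => /orP[->//|/sub1->]; rewrite orbT.
  move=> u /=; rewrite !inE => /orP[->|/sub2[->|[-> zq]]]; [by left|by left; rewrite orbT|].
  by right; rewrite zq orbT.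
case/exists_inP=> v Nv /and3P[ezu /connectP[s0 /shortenP[s rs us _] ->] evy] {s0 Nv}.
have [es sN] := path_restr rs.
have Eb : belast x ((u :: s) ++ y :: q') = x :: (u :: s) ++ belast y q'.
  by rewrite /= belast_cat /= -cat_rcons -lastI.
have usN a : a \in u :: s -> a \in N by rewrite inE => /orP[/eqP->|/sN].
have q'q a : a \in belast y q' -> a \in belast y q.
  by case/sub2=> // -[_]; rewrite -Exz (negPf nx).
have mem_belast' a : a \in belast y q -> a \in y :: q by apply: mem_belast.
exists ((u :: s) ++ y :: q'); rewrite Eb; split.
- by rewrite cat_path /= Exz ezu es evy.
- by rewrite last_cat.
- rewrite cons_uniq cat_uniq us uq' mem_cat negb_or nxq' (contra (usN x) Nx).
  apply/andP; split=> //; rewrite andbT /=; apply/hasPn => a /q'q/mem_belast' yqa.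
  by apply: (contra (usN a)); apply: nN; rewrite inE yqa orbT.
- move=> a; rewrite !(inE, mem_cat) => /orP[->//|/sub1->]; by rewrite !orbT.
move=> a; rewrite inE mem_cat => /or3P[/eqP->|/usN ->|/q'q aq].
- by left; rewrite mem_head.
- by right; rewrite Exz mem_head.
- by left; rewrite inE aq orbT.
Qed.

(* By Menger, three disjoint paths lead from C to w.  Unlike the paths, the cut
   condition lifts along contractions without modification. *)
Definition wheel_at A e C w :=
  [/\ cycle e C, uniq C, 2 < size C, {subset C <= A} & w \in A] /\
  [/\ w \notin C & forall Y, Y \subset A -> w \in Y ->
       {in C, forall u, u \notin Y} -> 2 < #|in_nbrs A e Y|].

Definition wheel A e := exists C w, wheel_at A e C w.

Lemma wheel_sub A B e : A \subset B -> wheel A e -> wheel B e.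
Proof.
move=> sAB [C [w [[cC uC sC CA wA] [nwC cut]]]]; exists C, w; split; split=> //.
- by move=> u /CA/(subsetP sAB).
- exact: (subsetP sAB).
move=> Y sY wY CY; apply: leq_trans (cut (Y :&: A) _ _ _) _.
- exact: subsetIr.
- by rewrite inE wY.
- by move=> u /CY; rewrite inE => /negPf->.
apply/subset_leq_card/subsetP => x /in_nbrsP[Ax nY [y /setIP[Yy Ay] exy]].
apply/in_nbrsP; split; [exact: (subsetP sAB) | | by exists y].
by apply: contra nY => Yx; rewrite inE Yx.
Qed.

(** The cycle lifts by [lift_short]. For the cuts, [Y :\: N] has at most as many in-neighbours in
    the contraction as [Y] has in [A]. *)
Lemma wheel_short A e N z :
  N \subset A -> z \in A :\: N -> wheel (A :\: N) (short e N z) -> wheel A e.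
Proof.
move=> sNA /setDP[Az nNz] [[|x p] [w [[cC uC sC CA wA] [nwC cut]]]] //.
have pN : {in x :: rcons p x, forall u, u \notin N}.
  move=> u; rewrite -rcons_cons mem_rcons inE => /orP[/eqP->|/CA/setDP[]//].
  by have /setDP[] := CA x (mem_head _ _).
have Ex q : belast x (rcons q x) = x :: q by rewrite belast_rcons.
have [|p' []] := lift_short cC pN; first by rewrite Ex.
rewrite Ex last_rcons; case: (lastP p') => [|p1 l].
  by move=> _ _ _ /(_ x); rewrite mem_head => /(_ isT).
rewrite last_rcons => e' El; rewrite {}El Ex in e' * => u' sub1 sub2.
have /setDP[Aw nNw] := wA.
have C'N u : u \in x :: p1 -> u \in x :: p \/ u \in N.
  by move/sub2 => [|[]]; [left|right].
exists (x :: p1), w; split; split=> //.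
- by apply: leq_trans sC _; apply: uniq_leq_size.
- move=> u /C'N[/CA/setDP[]//|]; exact: (subsetP sNA).
- by apply/negP => /C'N[|]; apply/negP.
move=> Y sYA Yw CY.
apply: leq_trans (cut (Y :\: N) _ _ _) _.
- by apply: setSD.
- by rewrite inE nNw.
- by move=> u /sub1/CY; rewrite inE => /negPf->; rewrite andbF.
set I := in_nbrs A e Y; set J := in_nbrs _ _ _.
have JI u : u \in J -> u != z -> u \in I.
  case/in_nbrsP=> /setDP[Au nNu]; rewrite inE nNu => /= nYu [y /setDP[Yy _]].
  by case/orP=> [euy _|/and3P[->//]]; apply/in_nbrsP; split=> //; exists y.
have [Iz|nIz] := boolP ((z \in I) || (z \notin J)).
  apply/subset_leq_card/subsetP => u Ju; have [Eu|] := eqVneq u z; last exact: JI.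
  by case/orP: Iz; rewrite -Eu // Ju.
move: nIz; rewrite negb_or negbK => /andP[nIz Jz].
have [_] := in_nbrsP _ _ _ _ Jz; rewrite inE nNz /= => nYz [y /setDP[Yy nNy]].
have noe v : e z v -> v \notin Y.
  by move=> ezv; apply: contra nIz => Yv; apply/in_nbrsP; split=> //; exists v.
case/orP=> [/noe/negP//|/and3P[_ _ /exists_inP[u Nu /exists_inP[v Nv]]]].
case/and3P=> /noe nYu cuv evy.
(* Here [z] reaches [Y] only through [N]. The path starts outside [Y], so one of its vertices in [N]
   is an in-neighbour of [Y] and makes up for [z]. *)
have [n Nn In] : exists2 n, n \in N & n \in I.
  have [Yv|nYv] := boolP (v \in Y); last first.
    by exists v => //; apply/in_nbrsP; split; rewrite ?(subsetP sNA) //; exists y.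
  have [a [b [/and3P[Na _ eab] nYa Yb _]]] := connect_cross cuv nYu Yv.
  by exists a => //; apply/in_nbrsP; split; rewrite ?(subsetP sNA) //; exists b.
rewrite (cardsD1 z) Jz (cardsD1 n I) In ltnS; apply/subset_leq_card/subsetP.
move=> a /setD1P[naz Ja]; rewrite in_setD1 JI // andbT; apply: contraTneq Ja => ->.
by apply/negP => /in_nbrsP[]; rewrite inE Nn.
Qed.
End Wheel.

(** * Existence of wheels *)

Section WheelThm.
Variable T : finType.
Implicit Types (e r : rel T) (A B N Y S : {set T}) (x y z w : T) (C : seq T).

(** On a longest path [x :: p] lie all in-neighbours of [x]. Of two that differ from the head of
    [p], the one nearer to [x] closes a cycle of length at least three, which misses the other. *)
Lemma long_cycle A e : irreflexive e -> A != set0 ->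
  (forall v, v \in A -> 2 < #|in_nbrs A e [set v]|) ->
  exists C w, [/\ cycle e C, uniq C & 2 < size C] /\
              [/\ {subset C <= A}, w \in A & w \notin C].
Proof.
move=> ie /set0Pn[x0 Ax0] deg; set goal := exists C, _.
suff long n : goal \/ exists x p, [/\ path e x p, uniq (x :: p),
    {subset x :: p <= A} & n < size (x :: p)].
  have [//|[x [p [_ ux _ sz]]]] := long #|T|.
  by have := max_card (mem (x :: p)); rewrite (card_uniqP ux) leqNgt sz.
elim: n => [|n [|[x [p [ep ux sA sz]]]]]; [|by left|].
  by right; exists x0, [::]; split=> // u; rewrite inE => /eqP->.
have Ax : x \in A by apply: sA; rewrite mem_head.
have [/existsP[y /andP[Iy nyp]] | /existsPn all] :=
  boolP [exists y, (y \in in_nbrs A e [set x]) && (y \notin p)].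
  right; exists y, (x :: p); have [Ay nyx [x' /set1P-> eyx]] := in_nbrsP _ _ _ _ Iy.
  split=> //=; first by rewrite eyx.
    by move: ux nyx => /= ->; rewrite !inE negb_or nyp => ->.
  by move=> u; rewrite inE => /orP[/eqP->//|/sA].
have Ip y : y \in in_nbrs A e [set x] -> y \in p.
  by move=> Iy; have := all y; rewrite Iy /= negbK.
left; have : 1 < #|in_nbrs A e [set x] :\ head x p|.
  by have := deg x Ax; rewrite (cardsD1 (head x p)); case: (_ \in _) => // /ltnW.
case/card_gt1P=> y [y' [/setD1P[nyh Iy] /setD1P[ny'h Iy'] nyy']].
have key a b : a \in p -> b \in p -> e a x -> a != head x p ->
    index a p < index b p -> goal.
  move=> pa pb eax nah lt.
  have ia : 0 < index a p.
    by case: (p) pa nah => //= c q; rewrite inE => _ /negPf; rewrite eq_sym => ->.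
  have [sa sb] : index a p < size p /\ index b p < size p by rewrite !index_mem.
  exists (x :: take (index a p).+1 p), b.
  have Et : take (index a p).+1 p = rcons (take (index a p) p) a.
    by rewrite (take_nth x) ?nth_index.
  split; split.
  - by rewrite /= rcons_path take_path // Et last_rcons.
  - by move: ux => /= /andP[nx up]; rewrite take_uniq // andbT;
      apply: contra nx; apply: mem_take.
  - by rewrite /= size_takel // !ltnS.
  - by move=> u; rewrite inE => /orP[/eqP->//|/mem_take pu]; apply: sA; rewrite inE pu orbT.
  - by apply: sA; rewrite inE pb orbT.
  rewrite inE negb_or in_take_leq //; rewrite -leqNgt lt andbT.
  by apply: contraTneq ux => <-; rewrite /= pb.
have [[Ay _ [x1 /set1P-> ey]] [Ay' _ [x2 /set1P-> ey']]] :=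
  (in_nbrsP _ _ _ _ Iy, in_nbrsP _ _ _ _ Iy').
have [lt|le] := ltnP (index y p) (index y' p); first by apply: key lt; auto.
apply: (key y' y); auto; rewrite ltn_neqAle le andbT; apply: contra nyy' => /eqP E.
by rewrite -(nth_index x (Ip _ Iy)) -E nth_index ?Ip.
Qed.

Lemma wheel_biconn A e : irreflexive e -> A != set0 -> biconn A e ->
  (forall v, v \in A -> 2 < #|in_nbrs A e [set v]|) -> wheel A e.
Proof.
move=> ie A0 bA deg; apply: contrapT => nW.
have cut C w : cycle e C -> uniq C -> 2 < size C -> {subset C <= A} -> w \in A ->
    w \notin C -> exists Y, [/\ Y \subset A, w \in Y, {in C, forall u, u \notin Y} &
                                #|in_nbrs A e Y| <= 2].
  move=> cC uC sC CA Aw nwC; apply: contrapT => nY; apply: nW.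
  exists C, w; split; split=> // Y YA wY CY; rewrite ltnNge; apply/negP => le2.
  by apply: nY; exists Y.
(* The last condition holds for every cut around a cycle of length at least three; it provides a
   vertex outside [Y0] besides [s] and [t]. *)
pose P Y := [&& Y \subset A, Y != set0, #|in_nbrs A e Y| <= 2 & 2 < #|A :\: Y|].
have cutP C Y w : Y \subset A -> uniq C -> 2 < size C -> {subset C <= A} ->
    {in C, forall u, u \notin Y} -> w \in Y -> #|in_nbrs A e Y| <= 2 -> P Y.
  move=> YA uC sC CA CY wY le2; apply/and4P; split=> //; first by apply/set0Pn; exists w.
  apply: leq_trans sC _; rewrite -(card_uniqP uC); apply/subset_leq_card/subsetP.
  by move=> u Cu; rewrite inE CY ?CA.
have [Y1 PY1] : exists Y, P Y.
  have [C [w [[cC uC sC] [CA Aw nwC]]]] := long_cycle ie A0 deg.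
  have [Y [YA wY CY le2]] := cut C w cC uC sC CA Aw nwC.
  by exists Y; apply: cutP YA uC sC CA CY wY le2.
case: (arg_minnP (fun Y => #|Y|) PY1) => Y0 /and4P[Y0A Y00 le2 gt2] minY.
have {Y1 PY1} minY0 Y : Y \subset Y0 -> Y != Y0 -> Y != set0 -> 2 < #|in_nbrs A e Y|.
  move=> sY nY Y_0; rewrite ltnNge; apply/negP => le.
  have : #|Y| < #|Y0| by apply: proper_card; rewrite properEneq nY.
  rewrite ltnNge minY //; apply/and4P; split=> //; first exact: subset_trans Y0A.
  by apply: leq_trans gt2 _; apply/subset_leq_card/setDS.
have bA' := biconn_conv bA.
have gt1 : 1 < #|A :\: Y0| by apply: ltnW.
have [s [t [nst Est]]] : exists s t, s != t /\ in_nbrs A e Y0 = [set s; t].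
  have /cards2P[s [t [nst E]]] : #|in_nbrs A e Y0| == 2.
    by rewrite eqn_leq le2 bA.
  by exists s, t.
have inNY0 x y : x \in A -> x \notin Y0 -> y \in Y0 -> e x y -> x = s \/ x = t.
  move=> Ax nx Yy exy; have : x \in in_nbrs A e Y0 by apply/in_nbrsP; split=> //; exists y.
  by rewrite Est => /set2P.
have /in_nbrsP[As nsY [y0 Yy0 esy0]] : s \in in_nbrs A e Y0 by rewrite Est set21.
have /in_nbrsP[At ntY _] : t \in in_nbrs A e Y0 by rewrite Est set22.
have Y0A' u : u \in Y0 -> u \in A by apply: (subsetP Y0A).
have inst u : u \in [set s; t] -> u \in A :\: Y0.
  by rewrite -Est => /in_nbrsP[Au nu _]; apply/setDP.
(* The arcs from [s] to [Y0] do not all end in one vertex [y]: otherwise [Y0 :\ y] would be entered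
   only from [y] and [t], against minimality. *)
have two y : exists2 y', y' \in Y0 & (y' != y) && e s y'.
  have [/existsP[y' /and3P[]] | /existsPn all] :=
    boolP [exists y', [&& y' \in Y0, y' != y & e s y']].
    by move=> Yy' nyy' es; exists y'; rewrite // nyy'.
  have only y' : y' \in Y0 -> e s y' -> y' = y.
    by move=> Yy' es; apply/eqP; have := all y'; rewrite Yy' es andbT negbK.
  have Ey := only _ Yy0 esy0.
  have Y0D : Y0 :\ y != set0.
    apply: contraL le2 => /eqP D0; rewrite -ltnNge.
    have -> : Y0 = [set y] by rewrite -Ey -[LHS](setD1K Yy0) Ey D0 setU0.
    by apply: deg; rewrite -Ey Y0A'.
  have : 2 < #|in_nbrs A e (Y0 :\ y)|.
    apply: minY0 => //; first exact: subsetDl.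
    by apply: contraTneq Yy0 => <-; rewrite Ey !inE eqxx.
  rewrite ltnNge => /negP[]; rewrite -[2](_ : #|[set y; t]| = 2); last first.
    rewrite cards2; case: eqVneq => // Eyt.
    by case/negP: ntY; rewrite -Eyt -Ey.
  apply/subset_leq_card/subsetP => x /in_nbrsP[Ax nx [v /setD1P[nvy Yv] exv]].
  have [Yx|nYx] := boolP (x \in Y0).
    by move: nx; rewrite !inE Yx andbT negbK => ->.
  have [Ex|->] := inNY0 x v Ax nYx Yv exv; last by rewrite set22.
  by move: nvy; rewrite (only v) -?Ex ?eqxx.
(* The part of [Y0] not reached from [s] inside [Y0] would be entered only from [t]. *)
have reachY y : y \in Y0 -> exists2 y1, y1 \in Y0 & e s y1 && connect (restr Y0 e) y1 y.
  pose U := [set v in Y0 | [exists u in Y0, e s u && connect (restr Y0 e) u v]].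
  move=> Yy; apply/exists_inP; apply: contraT => nR.
  have nD0 : Y0 :\: U != set0 by apply/set0Pn; exists y; rewrite !inE Yy (negPf nR).
  have : 1 < #|in_nbrs A e (Y0 :\: U)|.
    apply: bA nD0 _; first exact: subset_trans (subsetDl _ _) Y0A.
    by apply: leq_trans gt1 _; apply/subset_leq_card/setDS/subsetDl.
  rewrite ltnNge -(cards1 t) => /negP[]; apply/subset_leq_card/subsetP.
  move=> x /in_nbrsP[Ax nx [v /setDP[Yv nUv] exv]]; rewrite inE.
  have [Yx|nYx] := boolP (x \in Y0).
    have Ux : x \in U by move: nx; rewrite in_setD Yx andbT negbK.
    case/negP: nUv; move: Ux; rewrite !inE Yx Yv /= => /exists_inP[u Yu /andP[su cu]].
    apply/exists_inP; exists u => //; rewrite su /=; apply: connect_trans cu _.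
    by apply: connect1; apply/and3P.
  have [Ex|->//] := inNY0 x v Ax nYx Yv exv; case/negP: nUv; rewrite inE Yv /=.
  by apply/exists_inP; exists v; rewrite // -Ex exv connect0.
(* The vertices that do not reach [s] outside [Y0] and [t] would have [t] as their only
   out-neighbour. *)
have reachM m : m \in A -> m \notin Y0 -> m != t ->
    connect (restr (A :\: Y0 :\ t) e) m s.
  move=> Am nYm nmt; apply: contraT => nR.
  pose U := [set v in A :\: Y0 :\ t | ~~ connect (restr (A :\: Y0 :\ t) e) v s].
  have Mm : m \in A :\: Y0 :\ t by rewrite !inE nmt nYm.
  have nsU : s \notin U by rewrite inE connect0 andbF.
  have sUA : U \subset A by apply/subsetP => v; rewrite inE => /andP[/setD1P[_ /setDP[]]].
  have : 1 < #|in_nbrs A (conv e) U|.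
    apply: bA' => //; first by apply/set0Pn; exists m; rewrite inE Mm.
    apply: (@leq_trans #|[set s; t]|); first by rewrite cards2 nst.
    apply/subset_leq_card/subsetP => v /set2P[]->; rewrite in_setD ?nsU //.
    by rewrite At !inE eqxx.
  rewrite ltnNge -(cards1 t) => /negP[]; apply/subset_leq_card/subsetP.
  move=> x /in_nbrsP[Ax nUx [v /setIdP[Mv nv] evx]].
  rewrite inE; apply: contraT => nxt.
  have /setD1P[nvt /setDP[Av nYv]] := Mv.
  have [Yx|nYx] := boolP (x \in Y0).
    have [Ev|Ev] := inNY0 v x Av nYv Yx evx; last by rewrite Ev eqxx in nvt.
    by rewrite Ev connect0 in nv.
  have Mx : x \in A :\: Y0 :\ t by rewrite !inE nxt nYx.
  move: nUx; rewrite inE Mx negbK => cx; case/negP: nv.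
  by apply: connect_trans cx; apply: connect1; apply/and3P.
have sMt : A :\: Y0 :\ t \subset A :\: Y0 by apply: subsetDl.
(* The cycle has to leave [Y0] to a vertex other than [s]: then it has two vertices outside [Y0], as
   the final uncrossing requires. *)
have [y [m [Yy AYm nms eym cms]]] : exists y m, [/\ y \in Y0, m \in A :\: Y0,
    m != s, e y m & connect (restr (A :\: Y0) e) m s].
  have [m Im nms] : exists2 m, m \in in_nbrs A (conv e) Y0 & m != s.
    have := bA' _ Y0A Y00 gt1; rewrite (cardsD1 s).
    have [->|[m /setD1P[nms Im]]] := set_0Vmem (in_nbrs A (conv e) Y0 :\ s).
      by rewrite cards0; case: (_ \in _).
    by exists m.
  have /in_nbrsP[Am nYm [y Yy eym]] := Im.
  have AYm : m \in A :\: Y0 by apply/setDP.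
  have [Emt|nmt] := eqVneq m t; last first.
    by exists y, m; split=> //; apply: connect_restr_sub sMt _ _ (reachM m Am nYm nmt).
  have [/existsP[m' /andP[AYm' etm']] | /existsPn none] :=
    boolP [exists m', (m' \in A :\: Y0) && e t m'].
    exists y, m; split=> //; rewrite Emt.
    have : connect (restr (A :\: Y0) e) t m'.
      by apply: connect1; apply/and3P; split=> //; apply/setDP.
    move/connect_trans; apply; have /setDP[Am' nYm'] := AYm'.
    have nm't : m' != t by apply: contraTneq etm' => ->; rewrite ie.
    by apply: connect_restr_sub sMt _ _ (reachM m' Am' nYm' nm't).
  (* Now the exit is [t], without out-neighbours outside [Y0]. The set [N] has an in-neighbour other
     than [s]; it is not [t] either, so it lies in [Y0] and provides another exit. *)
  pose N := A :\: Y0 :\: [set s; t].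
  have sN : N \subset A by apply: subset_trans (subsetDl _ _) (subsetDl _ _).
  have N0 : N != set0.
    rewrite -card_gt0 /N cardsD (setIidPr _); first by rewrite cards2 nst subn_gt0.
    by apply/subsetP => u /inst.
  have : 1 < #|in_nbrs A e N|.
    apply: bA => //; apply: (@leq_trans #|[set s; t]|); first by rewrite cards2 nst.
    apply/subset_leq_card/subsetP => v st; have /setDP[Av _] := inst v st.
    by rewrite /N in_setD Av in_setD st.
  case/card_gt1P=> a [b [Ia Ib nab]].
  have [x Ix nxs] : exists2 x, x \in in_nbrs A e N & x != s.
    by have [Ea|] := eqVneq a s; [exists b; rewrite // -Ea eq_sym | exists a].
  have /in_nbrsP[Ax nNx [v /setDP[/setDP[Av nYv] nst_v] exv]] := Ix.
  have nxt : x != t.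
    by apply/eqP => Ext; have := none v; rewrite -Ext exv andbT; case/negP; apply/setDP.
  have Yx : x \in Y0.
    by apply: contraNT nNx => nYx; rewrite in_setD in_set2 negb_or nxs nxt; apply/setDP.
  move: nst_v; rewrite !inE negb_or => /andP[nvs nvt].
  exists x, v; split=> //; first exact/setDP.
  exact: connect_restr_sub sMt _ _ (reachM v Av nYv nvt).
(* Take a path from an out-neighbour [y1] of [s] to [y]. A second out-neighbour [y2] is either
   missed by it, or gives a shortcut that misses [y1]. *)
have [q [w [[eq uq sq lq Yw] nwq]]] : exists q w, [/\ path e s q, uniq q,
    {subset q <= Y0}, last s q = y & w \in Y0] /\ w \notin q.
  have [y1 Yy1 /andP[es1 /connectP[p0 /shortenP[p rp up _] Ey]]] := reachY y Yy.
  have [ep sp] := path_restr rp.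
  have sp1 : {subset y1 :: p <= Y0} by move=> u; rewrite inE => /orP[/eqP->|/sp].
  have [y2 Yy2 /andP[n21 es2]] := two y1.
  have [y2p|ny2] := boolP (y2 \in y1 :: p); last first.
    by exists (y1 :: p), y2; split=> //; split=> //=; rewrite es1.
  have {y2p} : y2 \in p by move: y2p; rewrite inE (negPf n21).
  move=> y2p; case/splitPr: y2p ep up Ey sp1 {rp sp} => p1 p2.
  rewrite cat_path last_cat /= => /and3P[_ _ ep2] /andP[n1 up] Ey sp.
  exists (y2 :: p2), y1; split; first split=> //=.
  - by rewrite es2.
  - by move: up; rewrite cat_uniq => /and3P[].
  - by move=> u p2u; apply: sp; rewrite inE mem_cat p2u !orbT.
  by apply: contra n1 => H; rewrite mem_cat H orbT.
case: q eq uq sq lq nwq => [|a q]; first by move=> _ _ _ Es; rewrite -Es (negPf nsY) in Yy.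
move=> /= /andP[esa ea] uq sq lq nwq.
case/connectP: cms => p0 /shortenP[p rp up _] Ep {p0}.
have [ep sp] := path_restr rp.
have sp1 u : u \in m :: p -> u \in A :\: Y0 by rewrite inE => /orP[/eqP->|/sp].
case: p ep up Ep {rp sp} sp1 => [|b p]; first by move=> _ _ Es; rewrite Es eqxx in nms.
move=> ep up Ep sp.
pose C := (a :: q) ++ m :: b :: p.
have CA : {subset C <= A}.
  by move=> u; rewrite mem_cat => /orP[/sq/Y0A'//|/sp/setDP[]].
have [||||Y [YA wY CY leY]] := cut C w _ _ _ CA (Y0A' w Yw).
- rewrite /= rcons_cat cat_path ea lq /= eym /=; move: ep Ep => /= /andP[-> ep] Ep.
  by rewrite rcons_path ep -Ep esa.
- rewrite /C cat_uniq up andbT; apply/andP; split; first exact: uq.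
  apply/hasPn => u /sp/setDP[_].
  by apply: contra => /sq.
- by rewrite /C size_cat /= addSn !addnS.
- by rewrite /C mem_cat negb_or nwq; apply/negP => /sp/setDP[_]; rewrite Yw.
(* Uncrossing: the intersection misses [a] and so has three in-neighbours, the union misses [m] and
   [s] and so has two, but [Y0] and [Y] have only four together. *)
have lt2 : 2 < #|in_nbrs A e (Y0 :&: Y)|.
  apply: minY0; first exact: subsetIl.
    apply/eqP => E; have : a \in Y0 :&: Y by rewrite E sq ?mem_head.
    by rewrite inE (negPf (CY a _)) ?andbF // /C mem_head.
  by apply/set0Pn; exists w; rewrite inE Yw.
have := in_nbrs_submod A e Y0 Y.
have : 1 < #|in_nbrs A e (Y0 :|: Y)|.
  apply: bA; first by rewrite subUset Y0A.
    by apply/set0Pn; exists w; rewrite inE Yw.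
  apply: (@leq_trans #|[set m; s]|); first by rewrite cards2 nms.
  have Cm : m \in C by rewrite /C mem_cat mem_head orbT.
  have Cs : s \in C by rewrite /C mem_cat Ep mem_last orbT.
  apply/subset_leq_card/subsetP => v /set2P[]->; rewrite in_setD in_setU negb_or.
    by rewrite CY // CA // !andbT; have /setDP[] := AYm.
  by rewrite CY // As nsY.
move: lt2 le2 leY; clear; lia.
Qed.

Lemma biconn_failure A e : ~ biconn A e -> exists N z,
  [/\ N \subset A, N != set0, z \in A :\: N, 1 < #|A :\: N| & in_nbrs A e N \subset [set z]].
Proof.
move=> nbA; apply: contrapT => nE; apply: nbA => N NA N0 gt1.
rewrite ltnNge; apply/negP => le1; apply: nE.
have [I0|[z Iz]] := set_0Vmem (in_nbrs A e N).
  have /card_gt0P[z Mz] := ltnW gt1.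
  by exists N, z; split; rewrite // I0 sub0set.
exists N, z; split=> //; first by have /in_nbrsP[Az nNz _] := Iz; apply/setDP.
by have /eqP-> : [set z] == in_nbrs A e N by rewrite eqEcard sub1set Iz cards1.
Qed.

Lemma card_setD_lt A N : N \subset A -> N != set0 -> #|A :\: N| < #|A|.
Proof.
move=> NA /set0Pn[u Nu]; apply: proper_card; rewrite properE subsetDl.
by apply/subsetPn; exists u; [apply: (subsetP NA) | rewrite inE Nu].
Qed.

Theorem wheel_of_noncolorable A e :
  irreflexive e -> ~ colorable A e -> wheel A e.
Proof.
have [n] := ubnP #|A|; elim: n A e => // n IH A e ltA ie nA.
have [[v Av nv]|crit] := pselect (exists2 v, v \in A & ~ colorable (A :\ v) e).
  apply: wheel_sub (IH _ _ _ ie nv); first exact: subsetDl.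
  by move: ltA; rewrite (cardsD1 v) Av.
have crA : critical A e.
  split=> // v Av; apply: contrapT => nv; apply: crit; by exists v.
have [bA|/biconn_failure[N [z [NA N0 Mz gt1 Nz]]]] := pselect (biconn A e).
  apply: wheel_biconn => //; last by move=> v; apply: critical_deg.
  apply/eqP => A0; apply: nA; exists (fun=> ord0), (fun=> 0) => x y.
  by rewrite A0 inE.
apply: (wheel_short NA Mz).
apply: IH; [|exact: short_irr | exact: critical_glue crA NA Mz gt1 Nz].
rewrite -ltnS; apply: leq_trans ltA; rewrite ltnS; exact: card_setD_lt.
Qed.

End WheelThm.

(** * Triples of disjoint paths with a connection *)

Section Theta.
Variable T : finType.
Implicit Types (e r : rel T) (A B N Y S : {set T}) (a x y z w : T).

(* The members of two of the P i are connected, so at most one P i is empty and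
   at most one of the three paths is the arc from a to w. *)
Definition theta A e a w :=
  [/\ a \in A, w \in A, a != w & exists P : 'I_3 -> seq T,
    [/\ forall i, path e a (rcons (P i) w), forall i, uniq (P i),
        forall i, {subset P i <= A :\ a :\ w},
        forall i j u, u \in P i -> u \in P j -> i = j &
        exists i j u v, [/\ i != j, u \in P i, v \in P j &
                            connect (restr (A :\ a :\ w) e) u v]]].

Lemma theta_sub A B e a w : A \subset B -> theta A e a w -> theta B e a w.
Proof.
move=> sAB [Aa Aw naw [P [eP uP sP dP [i [j [u [v [nij Pu Pv cuv]]]]]]]].
have sAB' : A :\ a :\ w \subset B :\ a :\ w by do 2!apply: setSD.
split; rewrite ?(subsetP sAB) //; exists P; split=> //.
  by move=> i0 x /sP/(subsetP sAB').
exists i, j, u, v; split=> //; exact: connect_restr_sub sAB' _ _ cuv.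
Qed.

Lemma restr_conv A e : restr A (conv e) =2 conv (restr A e).
Proof. by move=> x y; rewrite /restr /conv andbCA. Qed.

Lemma theta_conv A e a w : theta A (conv e) w a -> theta A e a w.
Proof.
case=> Aa Aw naw [P [eP uP sP dP [i [j [u [v [nij Pu Pv cuv]]]]]]].
split=> //; first by rewrite eq_sym.
exists (fun i => rev (P i)); split.
- move=> i0; have := rev_path e w (rcons (P i0) a).
  by rewrite last_rcons belast_rcons rev_cons eP.
- by move=> i0; rewrite rev_uniq.
- by move=> i0 x; rewrite mem_rev => /sP; rewrite !inE andbCA.
- by move=> i0 j0 x; rewrite !mem_rev; apply: dP.
exists j, i, v, u; rewrite !mem_rev; split=> //; first by rewrite eq_sym.
move: cuv; rewrite (eq_connect (restr_conv _ _)) connect_conv.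
by congr (connect (restr _ _) _ _); apply/setP => x; rewrite !inE andbCA.
Qed.

(** As [z] is not the source, it is an inner vertex of at most one of the three paths. Only this
    path is rerouted through [N], so the lifted paths stay disjoint. *)
Lemma theta_short A e N z a w : N \subset A -> z \in A :\: N -> a != z ->
  theta (A :\: N) (short e N z) a w -> theta A e a w.
Proof.
move=> NA /setDP[Az nNz] naz [/setDP[Aa nNa] /setDP[Aw nNw] naw].
case=> P [eP uP sP dP [i [j [u [v [nij Pu Pv cuv]]]]]].
have naP k : a \notin P k by apply/negP => /sP; rewrite !inE eqxx andbF.
have nNP k x : x \in P k -> x \notin N by move/sP; rewrite !inE => /and3P[_ _ /andP[]].
have lift k : exists p, [/\ path e a (rcons p w), uniq (a :: p), {subset P k <= p} &
    forall x, x \in p -> x \in P k \/ x \in N /\ z \in P k].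
  have [||p' []] := lift_short (eP k).
  - move=> x; rewrite inE mem_rcons inE => /or3P[/eqP->|/eqP->|/nNP] //.
  - by rewrite belast_rcons /= naP uP.
  rewrite last_rcons belast_rcons; case: (lastP p') => [|p l].
    by move=> _ E; rewrite -E eqxx in naw.
  rewrite last_rcons belast_rcons => + El; rewrite El => e' u' sub1 sub2.
  exists p; split=> //.
    move=> x Px; have := sub1 x; rewrite !inE Px orbT => /(_ isT) /orP[/eqP Ex|//].
    by case/negP: (naP k); rewrite -Ex.
  move=> x px; have := sub2 x; rewrite !inE px orbT => /(_ isT).
  rewrite ![z == a]eq_sym (negPf naz) /= => -[/orP[/eqP Ex|Px]|]; [|by left|by right].
  by move: u' => /=; rewrite -Ex px.
have [P' P'P] := fin_all_exists lift.
split=> //; exists P'; split.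
- by move=> k; have [] := P'P k.
- by move=> k; have [_ /andP[]] := P'P k.
- move=> k x P'x; have [_ /andP[na _] _ sub] := P'P k.
  have nxa : x != a by apply: contraNneq na => <-.
  case: (sub x P'x) => [/sP|[Nx _]].
    by rewrite !inE => /and4P[-> -> _ ->].
  by rewrite !inE nxa (subsetP NA x Nx) !andbT; apply: contraNneq nNw => <-.
- move=> k l x P'k P'l; have [_ _ _ sk] := P'P k; have [_ _ _ sl] := P'P l.
  case: (sk x P'k) => [Pk|[Nx zk]]; case: (sl x P'l) => [Pl|[Nx' zl]].
  - exact: dP Pk Pl.
  - by case/negP: (nNP k x Pk).
  - by case/negP: (nNP l x Pl).
  - exact: dP zk zl.
exists i, j, u, v; have [_ _ si _] := P'P i; have [_ _ sj _] := P'P j.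
split; rewrite ?si ?sj //; move: cuv; apply: connect_sub => x y /and3P[Bx By].
have B'B b : b \in A :\: N :\ a :\ w -> b \in A :\ a :\ w.
  by rewrite !inE => /and4P[-> -> _ ->].
case/orP=> [exy|/and3P[/eqP Exz _ /exists_inP[p Np /exists_inP[q Nq]]]].
  by apply: connect1; apply/and3P; split; rewrite ?B'B.
move=> /and3P[ezp cpq eqy]; rewrite {}Exz in Bx *.
have NB n : n \in N -> n \in A :\ a :\ w.
  move=> Nn; rewrite !inE (subsetP NA) // andbT.
  by apply/andP; split; apply: contraTneq Nn => ->.
have By' := B'B _ By.
have Bz := B'B _ Bx.
have cz : connect (restr (A :\ a :\ w) e) z p.
  by apply: connect1; apply/and3P; split; [exact: Bz | exact: NB | exact: ezp].
have sNB : N \subset A :\ a :\ w by apply/subsetP.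
apply: connect_trans cz _; apply: (connect_trans (connect_restr_sub sNB cpq)).
by apply: connect1; apply/and3P; split; [exact: NB | exact: By' | exact: eqy].
Qed.

(** * Minimal sets with at most two in-neighbours *)

Section Structure.
Variables (A : {set T}) (e : rel T) (Y : {set T}).
Hypotheses (bA : biconn A e) (YA : Y \subset A) (Y0 : Y != set0).
Hypothesis leY : #|in_nbrs A e Y| <= 2.
Hypothesis ind : forall v, v \in A -> 2 < #|in_nbrs A e [set v]|.
Hypothesis outd : forall v, v \in A -> 2 < #|in_nbrs A (conv e) [set v]|.
Hypothesis minY : forall S, S \subset A -> S != set0 -> #|S| < #|Y| ->
  2 < #|in_nbrs A e S| /\ 2 < #|in_nbrs A (conv e) S|.

Lemma min_end_gt1 : 1 < #|Y|.
Proof.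
rewrite ltnNge; apply/negP => le1; have [y Yy] := set0Pn _ Y0.
have E : [set y] = Y by apply/eqP; rewrite eqEcard sub1set Yy cards1.
by have := ind (subsetP YA y Yy); rewrite E ltnNge leY.
Qed.

(** By minimality [S :&: Y] has three in-neighbours, so [S :|: Y] has at most one and misses at most
    one vertex. Thus [A :\: S] is contained in [Y :\: S] up to one vertex. *)
Lemma min_end_union S : S \subset A -> S :&: Y != set0 -> S :&: Y != Y ->
  #|in_nbrs A e S| <= 2 -> #|A :\: S| <= #|Y|.
Proof.
move=> SA SY0 SY leS.
have ltY : #|S :&: Y| < #|Y| by apply: proper_card; rewrite properEneq SY subsetIr.
have [lt _] : 2 < #|in_nbrs A e (S :&: Y)| /\ 2 < #|in_nbrs A (conv e) (S :&: Y)|.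
  by apply: minY => //; apply: subset_trans (subsetIl _ _) SA.
have le1 : #|A :\: (S :|: Y)| <= 1.
  rewrite leqNgt; apply/negP => gt1.
  have U0 : S :|: Y != set0 by apply: contraNneq Y0 => E; rewrite -subset0 -E subsetUr.
  have := bA _ U0 gt1; rewrite subUset SA YA => /(_ isT).
  by have := in_nbrs_submod A e S Y; move: lt leS leY; clear; lia.
have sub : A :\: S \subset (A :\: (S :|: Y)) :|: (Y :\: (S :&: Y)).
  apply/subsetP => u /setDP[Au nSu]; rewrite !inE (negPf nSu) Au /= andbT.
  by case: (u \in Y).
have := leq_trans (subset_leq_card sub) (leq_card_setU _ _).
have : 0 < #|S :&: Y| by rewrite card_gt0.
rewrite [#|Y :\: _|]cardsD setIA [Y :&: S]setIC -setIA setIid.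
by move: le1 ltY; clear; lia.
Qed.

(** The cut condition of [menger] for paths from the out-neighbours of [a] to the in-neighbours of
    [w]. An arc from [a] to [w] counts as a path, which leaves two to be found. *)
Lemma min_end_separator a w S : a \in Y -> w \in Y -> a != w ->
  let B := A :\ a :\ w in
  (forall x z, x \in [set x in B | e a x] :\: S -> z \in [set z in B | e z w] :\: S ->
     ~~ connect (restr (~: S) (restr B e)) x z) ->
  (if e a w then 2 else 3) <= #|S|.
Proof.
move=> Ya Yw naw B sep; rewrite leqNgt; apply/negP => ltS.
pose Z := [set z in B | e z w] :\: S.
pose r := restr (~: S) (restr B e).
(* The vertices that still reach [w] off [S]. They are entered only from [S], and from [a] if
   [a -> w] is an arc. *)
pose Y' := w |: [set x in B :\: S | [exists z in Z, connect r x z]].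
pose D := if e a w then [set a] else set0.
have cardSD : #|S :&: B| + #|D| <= 2.
  have := subset_leq_card (subsetIl S B); move: ltS; rewrite /D.
  by case: (e a w); rewrite ?cards1 ?cards0; clear; lia.
have rY x y : x \in A -> x \notin Y' -> y \in Y' -> e x y ->
    x \in S :&: B \/ [/\ x = a, y = w & e a w].
  move=> Ax; rewrite in_setU1 negb_or => /andP[nxw nx] Yy exy.
  have [Exa|nxa] := eqVneq x a.
    case/setU1P: Yy => [Ey|/setIdP[/setDP[By nSy] /exists_inP[z Zz cyz]]].
      by right; rewrite -Exa -Ey.
    have Xy : y \in [set x in B | e a x] :\: S.
      by rewrite in_setD nSy inE By -Exa.
    by have := sep y z Xy Zz; rewrite cyz.
  have Bx : x \in B by rewrite !inE nxw nxa.
  left; rewrite in_setI Bx andbT; apply: contraNT nx => nSx.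
  rewrite inE in_setD nSx Bx /=; apply/exists_inP.
  case/setU1P: Yy => [Ey|/setIdP[/setDP[By nSy] /exists_inP[z Zz cyz]]].
    by exists x; rewrite ?connect0 // in_setD nSx inE Bx -Ey.
  exists z => //; apply: connect_trans cyz; apply: connect1.
  apply/and3P; rewrite !in_setC; split=> //; exact/and3P.
have DP x : x = a -> e a w -> x \in D by move=> -> eaw; rewrite /D eaw inE.
have inY' : #|in_nbrs A e Y'| <= 2.
  apply: leq_trans cardSD; apply: leq_trans (leq_card_setU _ _).
  apply/subset_leq_card/subsetP => x /in_nbrsP[Ax nx [y Yy exy]]; rewrite inE.
  by case: (rY x y Ax nx Yy exy) => [->|[Ex _ eaw]] //; rewrite DP ?orbT.
have naY' : a \notin Y' by rewrite !inE (negPf naw) eqxx !andbF.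
have wY' : w \in Y' by rewrite !inE eqxx.
have Y'A : Y' \subset A.
  apply/subsetP => x; rewrite !inE => /orP[/eqP->|/andP[/and4P[]//]].
  exact: (subsetP YA).
have leAY' : #|A :\: Y'| <= #|Y|.
  apply: min_end_union => //.
    by apply/set0Pn; exists w; rewrite inE wY'.
  by apply: contraNneq naY' => E; move: Ya; rewrite -E inE => /andP[].
(* What lies before the cut. Its out-neighbours are in [S], except for [w] if [a -> w] is an arc, so
   by minimality it is at least as large as [Y]. *)
pose W := A :\: Y' :\: (S :&: B).
have outW : #|in_nbrs A (conv e) W| <= 2.
  pose D' := if e a w then [set w] else set0.
  have cardSD' : #|S :&: B| + #|D'| <= 2.
    by move: cardSD; rewrite /D /D'; case: (e a w); rewrite ?cards1 ?cards0.
  apply: leq_trans cardSD'; apply: leq_trans (leq_card_setU _ _).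
  apply/subset_leq_card/subsetP => y /in_nbrsP[Ay nWy [x /setDP[/setDP[Ax nx] nSx] exy]].
  rewrite inE; have [//|nSy /=] := boolP (y \in S :&: B).
  have Yy : y \in Y' by apply: contraNT nWy => nYy; rewrite in_setD nSy in_setD nYy.
  case: (rY x y Ax nx Yy exy) => [Sx|[_ -> eaw]]; first by rewrite Sx in nSx.
  by rewrite /D' eaw inE.
have Wa : a \in W by rewrite !inE (negPf naw) eqxx !andbF (subsetP YA).
have leW : #|Y| <= #|W|.
  rewrite leqNgt; apply/negP => ltW.
  have WA : W \subset A by apply: subset_trans (subsetDl _ _) (subsetDl _ _).
  have W0 : W != set0 by apply/set0Pn; exists a.
  by have [_] := minY WA W0 ltW; rewrite ltnNge outW.
(* Since [A :\: Y'] has at most [#|Y|] elements, removing [S :&: B] from it leaves at least [#|Y|]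
   only if nothing is removed. *)
have SB0 : S :&: B = set0.
  apply/eqP; rewrite -cards_eq0.
  have : S :&: B \subset A :\: Y'.
    apply/subsetP => x /setIP[Sx Bx]; have /setD1P[nxw /setD1P[_ Ax]] := Bx.
    by rewrite in_setD Ax andbT in_setU1 negb_or nxw inE in_setD Sx.
  move/setIidPr => E; move: leW; rewrite /W cardsD E.
  have := subset_leq_card (subsetIr (A :\: Y') (S :&: B)).
  by rewrite E; move: leAY'; have : 0 < #|Y| by [rewrite card_gt0]; clear; lia.
(* With [S :&: B] empty, [Y'] is entered from [a] alone, against 2-connectivity. *)
have : 1 < #|in_nbrs A e Y'|.
  apply: bA => //; first by apply/set0Pn; exists w.
  by apply: leq_trans (leq_trans min_end_gt1 leW) _; rewrite /W SB0 setD0.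
rewrite ltnNge => /negP[]; rewrite -(cards1 a); apply/subset_leq_card/subsetP.
move=> x /in_nbrsP[Ax nx [y Yy exy]]; rewrite inE; apply/eqP.
by case: (rY x y Ax nx Yy exy) => [|[]] //; rewrite SB0 inE.
Qed.

Lemma min_end_paths a w : a \in Y -> w \in Y -> a != w ->
  exists P : 'I_3 -> seq T,
    [/\ forall i, path e a (rcons (P i) w), forall i, uniq (P i),
        forall i, {subset P i <= A :\ a :\ w},
        forall i j u, u \in P i -> u \in P j -> i = j &
        exists i j, [/\ i != j, P i != [::], P j != [::] &
          forall k, k = i \/ k = j \/ P k != [::] \/ P k = [::] /\ e a w]].
Proof.
move=> Ya Yw naw; set B := A :\ a :\ w.
have sep := min_end_separator Ya Yw naw; rewrite -/B in sep.
have conv_p k (ps : 'I_k -> seq T) :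
    [/\ forall i, exists x q, [/\ ps i = x :: q, x \in [set x in B | e a x],
          last x q \in [set x in B | e x w] & path (restr B e) x q],
      forall i, uniq (ps i) & forall i j u, u \in ps i -> u \in ps j -> i = j] ->
    forall i, [/\ path e a (rcons (ps i) w), {subset ps i <= B} & ps i != [::]].
  case=> psP _ _ i; have [x [q [-> /setIdP[Bx eax] /setIdP[_ lw] rq]]] := psP i.
  have [eq sq] := path_restr rq; split=> //; first by rewrite /= rcons_path eax eq.
  by move=> u; rewrite inE => /orP[/eqP->|/sq].
case eaw: (e a w) sep => sep.
  have [ps psP] := menger sep; have [psE psu psd] := psP; have psC := conv_p _ ps psP.
  (* The index [ord_max] gets the empty path, which stands for the arc from [a] to [w]. *)
  pose P (i : 'I_3) := if unlift ord_max i is Some j then ps j else [::].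
  exists P; split; rewrite /P.
  - by move=> i; case: (unlift _ _) => [j|] /=; [have [] := psC j | rewrite eaw].
  - by move=> i; case: (unlift _ _).
  - by move=> i; case: (unlift _ _) => [j|//]; have [] := psC j.
  - move=> i j u; case: unliftP => [i'|] -> //; case: unliftP => [j'|] -> // pi pj.
    by rewrite (psd i' j' u).
  exists (lift ord_max ord0), (lift ord_max ord_max); rewrite !liftK; split=> //.
  - by have [] := psC ord0.
  - by have [] := psC ord_max.
  by move=> k; do 2!right; case: unliftP => [j|] _; [left; have [] := psC j | right].
have [ps psP] := menger sep; have [psE psu psd] := psP; have psC := conv_p _ ps psP.
exists ps; split=> //; try by move=> i; have [] := psC i.
exists ord0, ord_max; split=> //; try by have [] := psC ord0.
  by have [] := psC ord_max.
by move=> k; do 2!right; left; have [] := psC k.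
Qed.

Lemma min_end_theta a w : a \in Y -> w \in Y -> a != w -> theta A e a w.
Proof.
move=> Ya Yw naw; have [P [eP uP sP dP [i0 [i1 [ni P0 P1 rest]]]]] := min_end_paths Ya Yw naw.
have [Aa Aw] := (subsetP YA a Ya, subsetP YA w Yw).
apply: contrapT => nth; set B := A :\ a :\ w in sP.
have nconn i j u v : i != j -> u \in P i -> v \in P j -> ~~ connect (restr B e) u v.
  move=> nij Pu Pv; apply/negP => cuv; apply: nth; split=> //.
  by exists P; split=> //; exists i, j, u, v.
(* Assume that no two of the paths are connected in [B]. The set of vertices that reach [P i] in [B]
   is entered only from [a] and [w], and it avoids the other paths. *)
pose Z i := [set x in B | [exists u, (u \in P i) && connect (restr B e) x u]].
have PZ i u : u \in P i -> u \in Z i.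
  by move=> Pu; rewrite inE (sP i u Pu); apply/existsP; exists u; rewrite Pu connect0.
have PnZ i j u : i != j -> u \in P j -> u \notin Z i.
  move=> nij Pu; apply/negP => /setIdP[_ /existsP[v /andP[Pv]]]; apply/negP.
  by apply: nconn Pu Pv; rewrite eq_sym.
have stepZ i x y : x \in B -> y \in Z i -> e x y -> x \in Z i.
  move=> Bx /setIdP[By /existsP[u /andP[Pu cyu]]] exy; rewrite inE Bx /=.
  apply/existsP; exists u; rewrite Pu; apply: connect_trans cyu.
  by apply: connect1; apply/and3P.
have BP x : x \in A -> x \notin B -> x \in [set a; w].
  by move=> Ax; rewrite !inE Ax andbT -negb_or negbK orbC.
have BA x : x \in B -> x \in A by rewrite !inE => /and3P[].
have nBa : a \notin B by rewrite !inE eqxx andbF.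
have nBw : w \notin B by rewrite !inE eqxx.
have ZA i : Z i \subset A by apply/subsetP => x /setIdP[/BA].
have card_aw : #|[set a; w]| <= 2 by rewrite cards2; case: (a != w).
have inZ i : in_nbrs A e (Z i) \subset [set a; w].
  apply/subsetP => x /in_nbrsP[Ax nZx [y Zy exy]]; apply: BP => //.
  by apply: contra nZx => Bx; apply: stepZ Zy exy.
(* If [Z i] met [Y], its complement without [a] and [w] would be smaller than [Y], contain [P j],
   and have only [a] and [w] as out-neighbours. *)
have ZY i j : i != j -> P j != [::] -> Z i :&: Y = set0.
  move=> nij Pj; apply/eqP; apply: contraT => ZY0.
  have ZYY : Z i :&: Y != Y.
    by apply: contraNneq nBa => E; move: Ya; rewrite -E inE => /andP[/setIdP[]].
  have leZ := min_end_union (ZA i) ZY0 ZYY (leq_trans (subset_leq_card (inZ i)) card_aw).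
  pose X := A :\: Z i :\: [set a; w].
  have XA : X \subset A by apply: subset_trans (subsetDl _ _) (subsetDl _ _).
  have X0 : X != set0.
    case: (P j) Pj (@PnZ i j ^~ nij) (sP j) => // u q _ PnZ' sPj.
    apply/set0Pn; exists u; have Bu := sPj u (mem_head _ _).
    rewrite in_setD in_setD BA // PnZ' ?mem_head // andbT.
    by move: Bu; rewrite !inE negb_or => /and3P[-> -> _].
  have ltX : #|X| < #|Y|.
    rewrite /X cardsD (setIidPr _); last first.
      apply/subsetP => x /set2P[]->; rewrite in_setD ?Aa ?Aw andbT;
        by apply/negP => /setIdP[]; rewrite ?(negPf nBa) ?(negPf nBw).
    by rewrite cards2 naw; move: leZ (min_end_gt1); clear; lia.
  have [_] := minY XA X0 ltX; rewrite ltnNge => /negP[].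
  apply: leq_trans card_aw; apply/subset_leq_card/subsetP.
  move=> y /in_nbrsP[Ay nXy [x /setDP[/setDP[Ax nZx] nax] exy]].
  apply: contraNT nXy => nay; rewrite in_setD nay in_setD Ay andbT.
  apply: contra nZx => Zy; apply: stepZ Zy exy.
  by apply: contraT => /(BP x Ax); rewrite (negPf nax).
pose l i := last a (P i).
have lP i : P i != [::] -> l i \in P i.
  by rewrite /l; case: (P i) => //= x p _; apply: mem_last.
have lw i : e (l i) w by have := eP i; rewrite rcons_path => /andP[].
have nlY i : P i != [::] -> l i \notin Y.
  move=> Pi; have [j nij Pj] : exists2 j, i != j & P j != [::].
    by have [->|] := eqVneq i i0; [exists i1 | exists i0].
  apply/negP => Yl; have := in_set0 (l i).
  by rewrite -(ZY i j nij Pj) in_setI PZ ?Yl // lP.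
have lI i : P i != [::] -> l i \in in_nbrs A e Y.
  move=> Pi; apply/in_nbrsP; split; [exact/BA/sP/lP | exact: nlY | by exists w].
have ldiff i j : P i != [::] -> P j != [::] -> i != j -> l i != l j.
  by move=> /lP Pi /lP Pj; apply: contra => /eqP E; rewrite (dP i j (l i)) // E.
(* The ends of two nonempty paths are distinct in-neighbours of [Y], hence all of them. *)
have EY : in_nbrs A e Y = [set l i0; l i1].
  apply/esym/eqP; rewrite eqEcard cards2 ldiff // leY andbT.
  by apply/subsetP => x /set2P[]->; apply: lI.
have eaw : e a w.
  have [k nk0 nk1] : exists2 k : 'I_3, k != i0 & k != i1.
    have : 0 < #|~: [set i0; i1]| by rewrite cardsCs setCK cards2 card_ord ni.
    by case/card_gt0P=> k; rewrite !inE negb_or => /andP[]; exists k.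
  have [|[|[Pk|[]//]]] := rest k; try by move/eqP; rewrite ?(negPf nk0) ?(negPf nk1).
  have := lI k Pk; rewrite EY => /set2P[] E.
    by have := ldiff k i0 Pk P0 nk0; rewrite E eqxx.
  by have := ldiff k i1 Pk P1 nk1; rewrite E eqxx.
have n10 : i1 != i0 by rewrite eq_sym.
have ZY0 := ZY i0 i1 ni P1; have ZY1 := ZY i1 i0 n10 P0.
(* The union [U] of the three sets has no in-neighbour, so by 2-connectivity it misses at most one
   vertex, and that vertex would have no out-neighbour. *)
have AU x : x \in A -> [\/ x \in Y, x \in Z i0 | x \in Z i1].
  pose U := Y :|: (Z i0 :|: Z i1).
  have inU : in_nbrs A e U = set0.
    apply/eqP; apply: contraT => /set0Pn[u /in_nbrsP[Au]].
    rewrite !in_setU !negb_or => /and3P[nYu nZ0 nZ1] [y yU euy].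
    have Bu : u \in B.
      by apply: contraT => /(BP u Au)/set2P[] E; rewrite E ?Ya ?Yw in nYu.
    case/setUP: yU => [Yy|/setUP[] Zy]; last 2 first.
    - by rewrite (stepZ i0 u y Bu Zy euy) in nZ0.
    - by rewrite (stepZ i1 u y Bu Zy euy) in nZ1.
    have : u \in in_nbrs A e Y by apply/in_nbrsP; split=> //; exists y.
    rewrite EY => /set2P[] E.
      by rewrite E PZ ?lP in nZ0.
    by rewrite E PZ ?lP in nZ1.
  have UA : U \subset A by rewrite !subUset YA !ZA.
  have U0 : U != set0 by apply/set0Pn; exists a; rewrite inE Ya.
  move=> Ax; have [/setUP[|/setUP[]]|nUx] := boolP (x \in U); try by constructor.
  exfalso; have le1 : #|A :\: U| <= 1.
    by rewrite leqNgt; apply/negP => /(bA UA U0); rewrite inU cards0.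
  have EU : A :\: U = [set x].
    by apply/esym/eqP; rewrite eqEcard cards1 le1 sub1set in_setD nUx Ax.
  have := outd Ax; suff -> : in_nbrs A (conv e) [set x] = set0 by rewrite cards0.
  apply/eqP; apply: contraT => /set0Pn[y /in_nbrsP[Ay nyx [_ /set1P-> exy]]].
  have Uy : y \in U by apply: contraNT nyx => nUy; rewrite -EU in_setD nUy.
  by have := in_set0 x; rewrite -inU => /in_nbrsP[]; split=> //; exists y.
(* If [Y] has a third vertex, then [Y :\: [set a; w]] is smaller than [Y] and has only [a] and [w]
   as out-neighbours. *)
have [gt2|le2] := ltnP 2 #|Y|.
  pose S := Y :\: [set a; w].
  have awY : [set a; w] \subset Y by apply/subsetP => x /set2P[]->.
  have cS : #|S| = #|Y| - 2 by rewrite cardsD (setIidPr awY) cards2 naw.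
  have [||| _] := @minY S.
  - exact: subset_trans (subsetDl _ _) YA.
  - by rewrite -card_gt0 cS; move: gt2; clear; lia.
  - by rewrite cS; move: gt2; clear; lia.
  rewrite ltnNge => /negP[]; apply: leq_trans card_aw; apply/subset_leq_card/subsetP.
  move=> y /in_nbrsP[Ay nSy [x /setDP[Yx nax] exy]].
  have Bx : x \in B by apply: contraT => /(BP x (subsetP YA x Yx)); rewrite (negPf nax).
  have nZx i : Z i :&: Y = set0 -> y \notin Z i.
    by move=> E; apply/negP => /(stepZ i x y Bx)/(_ exy) Zx;
      have := in_set0 x; rewrite -E inE Zx Yx.
  have [Yy||] := AU y Ay; last 2 first.
  - by rewrite (negPf (nZx _ ZY0)).
  - by rewrite (negPf (nZx _ ZY1)).
  by apply: contraNT nSy => nay; rewrite in_setD nay.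
have YE : Y = [set a; w].
  apply/esym/eqP; rewrite eqEcard cards2 naw le2 andbT.
  by apply/subsetP => x /set2P[]->.
(* Now [Y] is [[set a; w]], and every arc that leaves [X] goes from [t] to [Y]. Either [t] is the
   only out-neighbour of the nonempty set [X :\ t], or [X] consists of [t], whose out-degree is then
   at most two. *)
pose t := l i1; pose X := Z i1 :\: Z i0.
have Pt : t \in P i1 := lP i1 P1.
have Xt : t \in X by apply/setDP; split; [exact: PZ | exact: PnZ Pt].
have XA : X \subset A by apply: subset_trans (subsetDl _ _) (ZA _).
have outX x y : x \in X -> y \in A -> e x y -> y \in X \/ y \in Y /\ x = t.
  move=> /setDP[Zx nZx] Ay exy; have Bx : x \in B by case/setIdP: Zx.
  have nZy : y \notin Z i0 by apply: contra nZx => Zy; apply: stepZ Zy exy.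
  have [Yy||Zy] := AU y Ay; last 2 first.
  - by rewrite (negPf nZy).
  - by left; rewrite in_setD nZy.
  right; split=> //; have : x \in in_nbrs A e Y.
    apply/in_nbrsP; split; [exact: BA | | by exists y].
    by apply/negP => Yx; have := in_set0 x; rewrite -ZY1 inE Zx Yx.
  by rewrite EY => /set2P[E|//]; rewrite E PZ ?lP in nZx.
have XY x : x \in X -> x \notin Y.
  by case/setDP=> Zx _; apply/negP => Yx; have := in_set0 x; rewrite -ZY1 inE Zx Yx.
have [X0|[x Xx]] := set_0Vmem (X :\ t); last first.
  have XtA : X :\ t \subset A by apply: subset_trans (subsetDl _ _) XA.
  have Xt0 : X :\ t != set0 by apply/set0Pn; exists x.
  have : 1 < #|in_nbrs A (conv e) (X :\ t)|.
    apply: (biconn_conv bA) => //; apply: leq_trans min_end_gt1 _.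
    apply/subset_leq_card/subsetP => y Yy; rewrite in_setD (subsetP YA) // andbT.
    by apply/negP => /setD1P[_ /XY]; rewrite Yy.
  rewrite ltnNge -(cards1 t) => /negP[]; apply/subset_leq_card/subsetP.
  move=> y /in_nbrsP[Ay nXy [u /setD1P[nut Xu] euy]]; rewrite inE.
  case: (outX u y Xu Ay euy) => [Xy|[_ E]]; last by rewrite E eqxx in nut.
  by move: nXy; rewrite in_setD1 Xy andbT negbK.
have := outd (subsetP XA t Xt); rewrite ltnNge => /negP[]; apply: leq_trans card_aw.
apply/subset_leq_card/subsetP => y /in_nbrsP[Ay nyt [_ /set1P-> ety]].
case: (outX t y Xt Ay ety) => [Xy|[Yy _]]; last by rewrite -YE.
by have := in_set0 y; rewrite -X0 in_setD1 Xy andbT => /negbT; rewrite negbK => /eqP E;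
  rewrite E inE eqxx in nyt.
Qed.

End Structure.

Lemma theta_biconn A e : A != set0 -> biconn A e ->
  (forall v, v \in A -> 2 < #|in_nbrs A e [set v]|) ->
  (forall v, v \in A -> 2 < #|in_nbrs A (conv e) [set v]|) ->
  exists2 Y : {set T}, 1 < #|Y| & {in Y &, forall a w, a != w -> theta A e a w}.
Proof.
move=> A0 bA ind outd.
pose Q Y := [&& Y \subset A, Y != set0 & (#|in_nbrs A e Y| <= 2) || (#|in_nbrs A (conv e) Y| <= 2)].
have QA : Q A.
  rewrite /Q subxx A0; suff -> : in_nbrs A e A = set0 by rewrite cards0.
  by apply/eqP; apply: contraT => /set0Pn[x /in_nbrsP[->]].
case: (arg_minnP (fun Y => #|Y|) QA) => Y /and3P[YA Y0 leY] minY.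
have min' S : S \subset A -> S != set0 -> #|S| < #|Y| ->
    2 < #|in_nbrs A e S| /\ 2 < #|in_nbrs A (conv e) S|.
  move=> SA S0; rewrite ltnNge => ltS; apply/andP; rewrite !ltnNge -negb_or.
  by apply: contra ltS => leS; apply: minY; rewrite /Q SA S0.
case/orP: leY => leY.
  exists Y; first exact: min_end_gt1 YA Y0 leY ind.
  by move=> a w; apply: (min_end_theta bA YA Y0 leY ind outd min').
have min'' S : S \subset A -> S != set0 -> #|S| < #|Y| ->
    2 < #|in_nbrs A (conv e) S| /\ 2 < #|in_nbrs A (conv (conv e)) S|.
  by move=> SA S0 ltS; have [] := min' S SA S0 ltS.
exists Y; first exact: min_end_gt1 YA Y0 leY outd.
move=> a w Ya Yw naw; apply: theta_conv.
by apply: (min_end_theta (biconn_conv bA) YA Y0 leY outd ind min''); rewrite // eq_sym.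
Qed.

(** In the 2-connected case two vertices of [Y] can be taken in either order. Otherwise one side of
    the cut at [y] is contracted, chosen so that the sink falls on the side without [z]. Lifting
    needs a source other than [y], which the first hypothesis supplies for any smaller digraph. *)
Lemma theta_sink A e z :
  (forall B f y, #|B| < #|A| -> irreflexive f -> ~ colorable B f ->
     exists a w, theta B f a w /\ a != y) ->
  (forall B y, #|B| < #|A| -> ~ colorable B e ->
     exists a w, theta B e a w /\ w != y) ->
  irreflexive e -> ~ colorable A e -> exists a w, theta A e a w /\ w != z.
Proof.
move=> IHsource IHsink ie nA.
have [[v Av nv]|crit] := pselect (exists2 v, v \in A & ~ colorable (A :\ v) e).
  have [|a [w [th nwz]]] := IHsink _ z _ nv; first by rewrite [ltnRHS](cardsD1 v) Av.
  by exists a, w; split=> //; apply: theta_sub th; apply: subsetDl.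
have crA : critical A e.
  split=> // v Av; apply: contrapT => nv; apply: crit; by exists v.
have [bA|/biconn_failure[N [y [NA N0 My gt1 Ny]]]] := pselect (biconn A e).
  have A0 : A != set0.
    apply/eqP => A0; apply: nA; exists (fun=> ord0), (fun=> 0) => x y.
    by rewrite A0 inE.
  have [||Y gt1 YP] := theta_biconn A0 bA.
  - by move=> v; apply: critical_deg.
  - by move=> v; apply: (critical_deg (e := conv e)) (critical_conv crA).
  have /card_gt1P[u [v [Yu Yv nuv]]] := gt1.
  have [Eu|nu] := eqVneq u z.
    by exists u, v; split; [apply: YP | rewrite -Eu eq_sym].
  by exists v, u; split=> //; apply: YP; rewrite // eq_sym.
have /setDP[Ay nNy] := My.
(* Contracting [N] leaves a sink outside [N], hence different from [z]. *)
have [Nz|nNz] := boolP (z \in N).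
  have nM := critical_glue crA NA My gt1 Ny.
  have [|a [w [th nay]]] := IHsource _ _ y _ (short_irr N y ie) nM.
    exact: card_setD_lt.
  exists a, w; split; first exact: (theta_short NA My nay th).
  by have [_ /setDP[_ nNw] _ _] := th; apply: contraNneq nNw => ->.
(* If [z] is outside [N], the other side is contracted in the reversed digraph. A source other than
   [y] there lies in [N], and reversal makes it a sink. *)
pose N' := A :\: N :\ y.
have N'A : N' \subset A by apply: subset_trans (subsetDl _ _) (subsetDl _ _).
have inN' x : x \in A :\: N' -> x = y \/ x \in N.
  move=> /setDP[Ax]; rewrite in_setD1 in_setD Ax andbT negb_and !negbK.
  by case/orP=> [/eqP|]; [left | right].
have N'0 : N' != set0 by rewrite -card_gt0; move: gt1; rewrite (cardsD1 y) My.
have M'y : y \in A :\: N' by rewrite in_setD Ay in_setD1 eqxx.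
have gt1' : 1 < #|A :\: N'|.
  have [u Nu] := set0Pn _ N0.
  apply: (@leq_trans #|[set u; y]|).
    by rewrite cards2; case: eqVneq => // E; rewrite -E Nu in nNy.
  apply/subset_leq_card/subsetP => x /set2P[]-> //.
  by rewrite in_setD (subsetP NA) // in_setD1 in_setD Nu andbF.
have Ny' : in_nbrs A (conv e) N' \subset [set y].
  apply/subsetP => x /in_nbrsP[Ax nN'x [u /setD1P[nuy /setDP[Au nNu]] eux]].
  have AN'x : x \in A :\: N' by apply/setDP.
  have [->|Nx] := inN' x AN'x; first by rewrite inE.
  have : u \in in_nbrs A e N by apply/in_nbrsP; split=> //; exists x.
  by move/(subsetP Ny); rewrite inE (negPf nuy).
have nM := critical_glue (critical_conv crA) N'A M'y gt1' Ny'.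
have ie' : irreflexive (conv e) by move=> x; apply: ie.
have [|a [w [th nay]]] := IHsource _ _ y _ (short_irr N' y ie') nM.
  exact: card_setD_lt.
exists w, a; split; first exact: theta_conv (theta_short N'A M'y nay th).
have [Aa _ _ _] := th; have [Ea|Na] := inN' a Aa; first by rewrite Ea eqxx in nay.
by apply: contraNneq nNz => <-.
Qed.

Theorem theta_of_noncolorable A e z : irreflexive e -> ~ colorable A e ->
  (exists a w, theta A e a w /\ w != z) /\ (exists a w, theta A e a w /\ a != z).
Proof.
have [n] := ubnP #|A|; elim: n A e z => // n IH A e z; rewrite ltnS => leA ie nA.
have sink f y : irreflexive f -> ~ colorable A f -> exists a w, theta A f a w /\ w != y.
  move=> if_ nf; apply: theta_sink => //.
    by move=> B g x ltB ig nB; have [] := IH B g x (leq_trans ltB leA) ig nB.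
  by move=> B x ltB nB; have [] := IH B f x (leq_trans ltB leA) if_ nB.
split; first exact: sink.
have [//||a [w [th nwz]]] := sink (conv e) z.
  by move/colorable_conv.
by exists w, a; split=> //; apply: theta_conv.
Qed.

End Theta.

(** * From patterns to subdivisions *)

(* The pattern lists the arcs of a digraph with vertices 0, ..., 3; bs are the
   branch vertices, and qs k are the inner vertices of the path for arc k. *)
Definition embeds (pat : seq (nat * nat)) (T : finType) (e : rel T) : Prop :=
  exists (x0 : T) (bs : seq T) (qs : seq (seq T)),
    [/\ size bs = 4, size qs = size pat, uniq (bs ++ flatten qs) &
        all (fun k => let p := nth (0, 0) pat k in
                path e (nth x0 bs p.1) (rcons (nth [::] qs k) (nth x0 bs p.2)))
            (iota 0 (size pat))].

Lemma flatten_uniq_nth (T : eqType) (qs : seq (seq T)) i j u :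
  uniq (flatten qs) -> u \in nth [::] qs i -> u \in nth [::] qs j -> i = j.
Proof.
elim: qs i j => [|q qs IH] [|i] [|j] //=; rewrite cat_uniq => /and3P[_ /hasPn dis uqs].
- move=> qu ju; have /dis/negP[] // : u \in flatten qs.
  by apply/flattenP; exists (nth [::] qs j) => //; apply: mem_nth; case: ltnP ju => // /(nth_default [::])->.
- move=> iu qu; have /dis/negP[] // : u \in flatten qs.
  by apply/flattenP; exists (nth [::] qs i) => //; apply: mem_nth; case: ltnP iu => // /(nth_default [::])->.
by move=> iu ju; rewrite (IH i j).
Qed.

Lemma flatten_uniq_mem (T : eqType) (qs : seq (seq T)) q :
  uniq (flatten qs) -> q \in qs -> uniq q.
Proof.
elim: qs => //= p qs IH; rewrite cat_uniq inE => /and3P[up _ uqs] /orP[/eqP->//|].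
exact: IH.
Qed.

Lemma embeds_contains (D K : digraph) pat (vs : seq K) :
  size vs = 4 -> (forall x : K, x \in vs) ->
  (forall x y : K, Defs.arc x y = ((index x vs, index y vs) \in pat)) ->
  embeds pat (@Defs.arc D) -> contains_subdivision D K.
Proof.
move=> svs vsP arcE [x0 [bs [qs [sbs sqs ubq /allP ep]]]].
move: ubq; rewrite cat_uniq => /and3P[ubs /hasPn dis uqs].
pose A := {a : K * K | Defs.arc a.1 a.2}.
pose phi (x : K) := nth x0 bs (index x vs).
have ltv x : index x vs < size bs by rewrite sbs -svs index_mem.
have phibs x : phi x \in bs by apply: mem_nth.
have idx_inj (x y : K) : index x vs = index y vs -> x = y.
  by move=> E; rewrite -(nth_index x (vsP x)) E nth_index.
have phi_inj : injective phi.
  by move=> x y /eqP; rewrite nth_uniq // => /eqP/idx_inj.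
pose pair (a : A) := (index (val a).1 vs, index (val a).2 vs).
have patP a : pair a \in pat by rewrite -arcE (valP a).
pose k a := index (pair a) pat.
have k_inj : injective k.
  move=> a b /(congr1 (nth (0, 0) pat)); rewrite !nth_index // => -[E1 E2].
  apply: val_inj; case: a b E1 E2 => [[a1 a2] /= pa] [[b1 b2] /= pb].
  by move=> /idx_inj-> /idx_inj->.
pose q a := nth [::] qs (k a).
have qP a : path (@Defs.arc D) (phi (val a).1) (rcons (q a) (phi (val a).2)).
  have := ep (k a); rewrite mem_iota add0n index_mem patP => /(_ isT).
  by rewrite nth_index.
have qqs a : q a \in qs by apply: mem_nth; rewrite sqs index_mem.
have qbs a u : u \in q a -> u \notin bs.
  move=> qu; apply: dis; apply/flattenP; by exists (q a).
pose l a := size (q a).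
pose g (v : subdiv_vertex l) : D :=
  match v with inl x => phi x | inr w => nth x0 (q (tag w)) (tagged w) end.
have gq (w : {a : A & 'I_(l a)}) : nth x0 (q (tag w)) (tagged w) \in q (tag w).
  by apply: mem_nth.
have g_inj : injective g.
  move=> [x|w] [y|w'] /=.
  - by move/phi_inj->.
  - by move=> E; have := qbs _ _ (gq w'); rewrite -E phibs.
  - by move=> E; have := qbs _ _ (gq w); rewrite E phibs.
  move=> E; have Et : tag w = tag w'.
    apply: k_inj; apply: (flatten_uniq_nth uqs (gq w)); rewrite E; exact: gq.
  case: w w' E Et => [a i] [b j] /= E Eab; case: b / Eab j E => j /eqP.
  rewrite nth_uniq ?(flatten_uniq_mem uqs) // => /eqP E.
  by congr (inr (Tagged _ _)); apply: val_inj.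
have garc u v : subdiv_arc u v -> Defs.arc (g u) (g v).
  have qPn a i : i < (l a).+1 -> Defs.arc (nth x0 (phi (val a).1 :: rcons (q a) (phi (val a).2)) i)
      (nth x0 (rcons (q a) (phi (val a).2)) i).
    by move=> lti; have /(pathP x0)/(_ i) := qP a; rewrite size_rcons; apply.
  case: u v => [x|w] [y|w'] /=.
  - case/existsP=> a /andP[/eqP Ea /eqP la0]; have := qP a.
    have -> : val a = (x, y) by exact: Ea.
    by rewrite (size0nil la0) /= andbT.
  - case/andP=> /eqP <- /eqP w0; have := qPn (tag w') 0 isT.
    by rewrite /= nth_rcons -w0 ltn_ord.
  - case/andP=> /eqP <- /eqP ws; have := qPn (tag w) (tagged w).+1 (ltn_ord (tagged w)).
    by rewrite /= !nth_rcons ltn_ord ws ltnn eqxx.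
  - case: w w' => [a i] [b j] /= /andP[/eqP Eab]; case: b / Eab j => j /eqP Ej.
    have := qPn a j (ltnW (ltn_ord j)); rewrite nth_rcons ltn_ord {1}Ej /=.
    by rewrite nth_rcons ltn_ord.
(* Only images of arcs of the subdivision are kept, since [D] may have further arcs between the same
   vertices. *)
pose sarc : rel D := fun u v =>
  [exists p : subdiv_vertex l, [exists p' : subdiv_vertex l,
    [&& g p == u, g p' == v & subdiv_arc p p']]].
have sarcP u v : sarc u v -> [/\ u \in g @: setT, v \in g @: setT & Defs.arc u v].
  case/existsP=> p /existsP[p' /and3P[/eqP<- /eqP<- /garc]].
  by split=> //; apply: imset_f.
have S_gt0 : 0 < #|g @: setT|.
  by rewrite card_imset // cardsT subdiv_gt0.
exists l, (Subdigraph sarcP S_gt0).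
pose h (p : subdivision l) : digraph_of_subdigraph (Subdigraph sarcP S_gt0) :=
  exist _ (g p) (imset_f g (in_setT p)).
have h_inj : injective h by move=> p p' /(congr1 val)/g_inj.
have cardh : #|digraph_of_subdigraph (Subdigraph sarcP S_gt0)| <= #|subdivision l|.
  by rewrite card_sig /= card_imset // cardsT.
have [f fK hK] := inj_card_bij h_inj cardh.
exists f; split; first by exists h.
move=> x y; rewrite -{2}(hK x) -{2}(hK y) /=; apply/idP/idP.
  by move=> a; apply/existsP; exists (f x); apply/existsP; exists (f y); rewrite !eqxx.
by case/existsP=> p /existsP[p' /and3P[/eqP/g_inj-> /eqP/g_inj->]].
Qed.

(** The four tournaments on four vertices up to isomorphism. The order of the arcs fixes the order
    of the paths in [embeds]; [pat_source] lists the arcs of [pat_sink] reversed one by one, as in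
    [embeds_conv]. *)
Definition pat_trans := [:: (0, 1); (0, 2); (0, 3); (1, 2); (1, 3); (2, 3)].
Definition pat_sink := [:: (0, 1); (1, 2); (2, 0); (0, 3); (1, 3); (2, 3)].
Definition pat_source := [:: (1, 0); (2, 1); (0, 2); (3, 0); (3, 1); (3, 2)].
Definition pat_strong := [:: (0, 1); (1, 2); (2, 3); (3, 0); (0, 2); (1, 3)].

Lemma embeds_conv pat (T : finType) (e : rel T) :
  embeds pat (conv e) -> embeds [seq (p.2, p.1) | p <- pat] e.
Proof.
case=> x0 [bs [qs [sbs sqs ubq /allP ep]]].
exists x0, bs, (map rev qs); split; rewrite ?size_map //.
  rewrite -(perm_uniq (_ : perm_eq (bs ++ flatten qs) _)) // perm_cat2l.
  by elim: qs {sqs ubq ep} => //= q qs IH; apply: perm_cat => //; rewrite perm_sym perm_rev.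
apply/allP => k kP; have ltk : k < size pat by move: kP; rewrite mem_iota.
have := ep k kP; rewrite (nth_map (0, 0)) // (nth_map [::]) ?sqs //=.
set q := nth _ qs k; set y := nth _ bs _; set x := nth _ bs _ => epk.
have := rev_path e y (rcons q x); rewrite last_rcons belast_rcons rev_cons => ->.
exact: epk.
Qed.

Lemma split_last (T : eqType) (a : pred T) s : has a s ->
  exists p1 y p2, [/\ s = p1 ++ y :: p2, a y & ~~ has a p2].
Proof.
elim: s => //= x s IH; have [/IH[p1 [y [p2 [-> ay np2]]]] _|ns] := boolP (has a s).
  by exists (x :: p1), y, p2.
by rewrite orbF => ax; exists [::], x, s.
Qed.

Lemma uniq_cat_disj (T : eqType) (s1 s2 : seq T) :
  uniq s1 -> uniq s2 -> (forall t, t \in s1 -> t \notin s2) -> uniq (s1 ++ s2).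
Proof.
move=> u1 u2 dis; rewrite cat_uniq u1 u2 andbT; apply/hasPn => t s2t.
by apply: contraL s2t => /dis.
Qed.

Section Patterns.
Variable T : finType.
Implicit Types (e r : rel T) (A B N Y S : {set T}) (a u v x y z w : T) (C : seq T).

(** The path is cut off at its first vertex in [S2] and then started at its last vertex in [S1]. *)
Lemma bridge r S1 S2 u v : connect r u v -> u \in S1 -> v \in S2 ->
  [disjoint S1 & S2] ->
  exists x y q, [/\ x \in S1, y \in S2, path r x (rcons q y), uniq q &
                    forall t, t \in q -> t \notin S1 /\ t \notin S2].
Proof.
move=> cuv S1u S2v dis; have [p [rp up lp bp]] := first_hit cuv S2v.
have [|p1 [x [p2 [E S1x np2]]]] := @split_last _ [in S1] (u :: p).
  by rewrite /= S1u.
have Elast : last u p = last x p2 by rewrite -[LHS](last_cons u) E last_cat.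
have rx : path r x p2.
  case: p1 E => [[<- <-]//|u1 p1 [_ Ep]].
  by move: rp; rewrite Ep cat_path => /andP[_ /andP[]].
have ux : uniq (x :: p2) by move: up; rewrite E cat_uniq => /and3P[].
case: (lastP p2) E Elast rx ux np2 => [|q y] E Elast rx ux np2.
  have : x \in S1 :&: S2 by rewrite inE S1x -[x]/(last x [::]) -Elast.
  by rewrite (disjoint_setI0 dis) inE.
rewrite last_rcons in Elast; exists x, y, q; split=> //.
- by rewrite -Elast.
- by move: ux; rewrite /= rcons_uniq => /and3P[].
move=> t qt; split.
  apply: contra np2 => S1t; apply/hasP; exists t => //.
  by rewrite mem_rcons inE qt orbT.
apply: bp; have -> : belast u p = p1 ++ x :: q.
  have := lastI u p; rewrite E -rcons_cons -rcons_cat => /rcons_inj[] //.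
by rewrite mem_cat inE qt !orbT.
Qed.

Lemma theta_embeds A e a w : theta A e a w -> embeds pat_trans e.
Proof.
case=> Aa Aw naw [P [eP uP sP dP [i [j [u [v [nij Pu Pv cuv]]]]]]].
(* Taking all other paths as the target makes the interior of the bridge avoid all three paths. *)
pose S1 := [set x in P i]; pose S2 := [set x | [exists k, (k != i) && (x \in P k)]].
have [|||b [c [q [S1b S2c rq uq nq]]]] := bridge cuv (S1 := S1) (S2 := S2).
- by rewrite inE.
- by rewrite inE; apply/existsP; exists j; rewrite eq_sym nij.
- rewrite -setI_eq0; apply: contraT => /set0Pn[x /setIP[]]; rewrite !inE => Px.
  by case/existsP=> k /andP[nki Pk]; rewrite (dP k i x) ?eqxx in nki.
have [eq sq] := path_restr rq.
rewrite inE in S1b; move: S2c; rewrite inE => /existsP[k /andP[nki Pkc]].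
have [m nmi nmk] : exists2 m : 'I_3, m != i & m != k.
  have : 0 < #|~: [set i; k]| by rewrite cardsCs setCK cards2 card_ord eq_sym nki.
  by case/card_gt0P=> m; rewrite !inE negb_or => /andP[]; exists m.
have aP l : a \notin P l by apply/negP => /sP; rewrite !inE eqxx andbF.
have wP l : w \notin P l by apply/negP => /sP; rewrite !inE eqxx.
have nqP l t : t \in q -> t \notin P l.
  move=> /nq[]; rewrite !inE => nPi nS; have [-> //|nli] := eqVneq l i.
  by apply: contra nS => Pt; apply/existsP; exists l; rewrite nli.
have sqB t : t \in q -> t \in A :\ a :\ w by move=> qt; apply: sq; rewrite mem_rcons inE qt orbT.
have aq : a \notin q by apply/negP => /sqB; rewrite !inE eqxx andbF.
have wq : w \notin q by apply/negP => /sqB; rewrite !inE eqxx.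
have dis l l' t : l != l' -> t \in P l -> t \notin P l'.
  by move=> nll' Pl; apply: contra nll' => Pl'; rewrite (dP l l' t).
have U : uniq ([:: a; w] ++ P i ++ P k ++ P m ++ q).
  rewrite /= !inE !mem_cat !negb_or naw !aP aq !wP wq /=.
  have dq l t : t \in P l -> t \notin q by move=> Pt; apply: contraL Pt; apply: nqP.
  apply: uniq_cat_disj => // [|t Pt]; last first.
    by rewrite !mem_cat !negb_or (dis i k) ?(dis i m) ?(dq i) // eq_sym.
  apply: uniq_cat_disj => // [|t Pt]; last first.
    by rewrite !mem_cat !negb_or (dis k m) ?(dq k) // eq_sym.
  by apply: uniq_cat_disj => // t; apply: dq.
have [p1 [p1' EPi]] : exists p1 p1', P i = p1 ++ b :: p1'.
  by case/splitPr: S1b => p1 p2; exists p1, p2.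
have [p2 [p2' EPk]] : exists p2 p2', P k = p2 ++ c :: p2'.
  by case/splitPr: Pkc => l1 l2; exists l1, l2.
(* The bridge [q] from [b] on [P i] to [c] on [P k] yields the transitive order [a], [b], [c], [w];
   the third path [P m] joins [a] to [w]. *)
exists a, [:: a; b; c; w], [:: p1; p2; P m; q; p1'; p2']; split=> //.
  rewrite -(perm_uniq (_ : perm_eq ([:: a; w] ++ P i ++ P k ++ P m ++ q) _)) //.
  apply/seq.permP => x; rewrite EPi EPk /= !(count_cat, cats0) /=.
  by clear; lia.
have := eP i; rewrite EPi rcons_cat cat_path /= => /and3P[e1 e2 e3].
have := eP k; rewrite EPk rcons_cat cat_path /= => /and3P[e4 e5 e6].
have E1 : path e a (rcons p1 b) by rewrite rcons_path e1.
have E2 : path e a (rcons p2 c) by rewrite rcons_path e4.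
by rewrite /= E1 E2 eP eq e3 e6.
Qed.

Lemma wheel_paths A e C w : wheel_at A e C w ->
  exists (x : 'I_3 -> T) (s : 'I_3 -> seq T),
    [/\ forall i, x i \in C, forall i, path e (x i) (rcons (s i) w),
        forall i, uniq (s i), forall i t, t \in s i -> [/\ t \in A, t != w & t \notin C] &
        forall i j t, t \in x i :: s i -> t \in x j :: s j -> i = j].
Proof.
case=> [[cC uC sC CA wA] [nwC cut]]; pose B := A :\ w.
pose X := [set x in C]; pose Z := [set x in B | e x w].
have [|ps [psE psu psd]] := @menger _ (restr B e) X Z 3.
  (* The vertices that reach [w] off [S] form a cut as in [wheel_at], and its in-neighbours all lie
     in [S]. *)
  move=> S sep; pose Y := w |: [set x in B :\: S |
    [exists z in Z :\: S, connect (restr (~: S) (restr B e)) x z]].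
  have YA : Y \subset A.
    by apply/subsetP => x /setU1P[->//|/setIdP[/setDP[/setD1P[]]]].
  have wY : w \in Y by rewrite setU11.
  have CY : {in C, forall u, u \notin Y}.
    move=> u Cu; apply/negP => /setU1P[Euw|/setIdP[/setDP[Bu nSu] /exists_inP[z Zz cz]]].
      by rewrite -Euw Cu in nwC.
    have Xu : u \in X :\: S by rewrite in_setD nSu inE.
    by have := sep u z Xu Zz; rewrite cz.
  apply: leq_trans (cut Y YA wY CY) _; apply/subset_leq_card/subsetP.
  move=> x /in_nbrsP[Ax]; rewrite in_setU1 negb_or => /andP[nxw nx] [y Yy exy].
  apply: contraNT nx => nSx; have Bx : x \in B by apply/setD1P.
  rewrite inE in_setD nSx Bx /=; apply/exists_inP.
  case/setU1P: Yy => [Ey|/setIdP[/setDP[By nSy] /exists_inP[z Zz cyz]]].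
    by exists x; rewrite ?connect0 // in_setD nSx inE Bx -Ey.
  exists z => //; apply: connect_trans cyz; apply: connect1.
  by apply/and3P; rewrite !in_setC; split=> //; apply/and3P.
(* Starting each path at its last vertex on [C] makes it meet [C] only there. *)
have trim i : exists xs : T * seq T, [/\ xs.1 \in C, path e xs.1 (rcons xs.2 w),
    uniq xs.2, forall t, t \in xs.2 -> [/\ t \in A, t != w & t \notin C] &
    {subset xs.1 :: xs.2 <= ps i}].
  have [x0 [q [E Xx0 /setIdP[_ lw] rq]]] := psE i.
  have [|p1 [x [p2 [Es Cx np2]]]] := @split_last _ [in C] (ps i).
    by rewrite E /=; move: Xx0; rewrite inE => ->.
  have [eq sq] := path_restr rq.
  have ex : path e x (rcons p2 w).
    rewrite rcons_path; move: Es; rewrite E; case: p1 => [[<- <-]|u1 p1 [_ Eq]].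
      by rewrite eq.
    by move: eq lw; rewrite Eq cat_path last_cat /= => /and3P[_ _ ->].
  exists (x, p2); split=> //=.
  - by have := psu i; rewrite Es cat_uniq /= => /and4P[].
  - move=> t p2t; have nCt : t \notin C.
      by apply: contra np2 => Ct; apply/hasP; exists t.
    have /setD1P[ntw At] : t \in B; last by [].
    have : t \in ps i by rewrite Es mem_cat inE p2t !orbT.
    rewrite E inE => /orP[/eqP Et|/sq//].
    by move: Xx0 nCt; rewrite inE Et => ->.
  by move=> t xt; rewrite Es mem_cat xt orbT.
have [xs xsP] := fin_all_exists trim.
exists (fun i => (xs i).1), (fun i => (xs i).2); split; try by move=> i; have [] := xsP i.
move=> i j t it jt; have [_ _ _ _ si] := xsP i; have [_ _ _ _ sj] := xsP j.
exact: psd (si t it) (sj t jt).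
Qed.

Lemma rot_split3 e C u x y : cycle e C -> uniq C -> u \in C -> x \in C -> y \in C ->
  u != x -> u != y -> x != y ->
  exists p q (r : seq T), [/\ path e u (rcons p x), path e x (rcons q y), path e y (rcons r u) &
                    perm_eq (u :: p ++ x :: q ++ y :: r) C] \/
                [/\ path e u (rcons p y), path e y (rcons q x), path e x (rcons r u) &
                    perm_eq (u :: p ++ y :: q ++ x :: r) C].
Proof.
move=> cC uC Cu Cx Cy nux nuy nxy; case: (rot_to Cu) => n C' EC.
have cC' : cycle e (u :: C') by rewrite -EC rot_cycle.
have perC : perm_eq (u :: C') C by rewrite -EC perm_rot.
have C'x : x \in C'.
  by have := perm_mem perC x; rewrite Cx inE eq_sym (negPf nux).
have C'y : y \in C'.
  by have := perm_mem perC y; rewrite Cy inE eq_sym (negPf nuy).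
case/splitPr: C'x cC' perC C'y {EC} => p1 p2 cC' perC.
rewrite mem_cat inE eq_sym (negPf nxy) /= => /orP[] py.
  case/splitPr: py cC' perC => p q cC' perC; exists p, q, p2; right.
  move: cC' perC; rewrite -!catA /= => cC' perC; split=> //; move: cC';
  by rewrite /cycle rcons_cat rcons_cons -cat_rcons cat_path last_rcons rcons_cat rcons_cons
       -cat_rcons cat_path last_rcons => /and3P[].
case/splitPr: py cC' perC => q r cC' perC; exists p1, q, r; left.
split=> //; move: cC';
  by rewrite /cycle rcons_cat rcons_cons -cat_rcons cat_path last_rcons rcons_cat rcons_cons
       -cat_rcons cat_path last_rcons => /and3P[].
Qed.

Lemma sink_embeds A e C w : wheel_at A e C w -> embeds pat_sink e.
Proof.
move=> W; have [[cC uC _ _ _] [nwC _]] := W.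
have [x [s [xC es us sC dis]]] := wheel_paths W.
have xdis i j : i != j -> x i != x j.
  by apply: contra => /eqP E; apply/eqP; apply: (dis i j (x i)); rewrite ?E mem_head.
have sdis i j t : i != j -> t \in s i -> t \notin s j.
  move=> nij si; apply: contra nij => sj; apply/eqP; apply: (dis i j t);
  by rewrite inE ?si ?sj orbT.
have wsC i t : t \in s i -> t \notin w :: C.
  by case/sC=> _ ntw ntC; rewrite inE negb_or ntw.
have core i j k p q (r : seq T) : i != j -> i != k -> j != k ->
    path e (x i) (rcons p (x j)) -> path e (x j) (rcons q (x k)) ->
    path e (x k) (rcons r (x i)) -> perm_eq (x i :: p ++ x j :: q ++ x k :: r) C ->
    embeds pat_sink e.
  move=> nij nik njk ep eq er perC.
  have U : uniq ((w :: C) ++ s i ++ s j ++ s k).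
    apply: uniq_cat_disj => [||t wCt]; first by rewrite /= nwC.
      apply: uniq_cat_disj => // [|t st]; last first.
        by rewrite mem_cat negb_or !(sdis i).
      by apply: uniq_cat_disj => // t; apply: sdis.
    have ns l : t \notin s l by apply: contraL wCt => /wsC.
    by rewrite !mem_cat !negb_or !ns.
  exists w, [:: x i; x j; x k; w], [:: p; q; r; s i; s j; s k]; split=> //.
    rewrite -(perm_uniq (_ : perm_eq ((w :: C) ++ s i ++ s j ++ s k) _)) //.
    apply/seq.permP => a; have /seq.permP/(_ a) := perC.
    rewrite /= !(count_cat, cats0) /= !(count_cat, cats0) /=; clear; lia.
  by rewrite /= ep eq er !es.
pose i1 : 'I_3 := lift ord0 ord0.
have n01 : ord0 != i1 by [].
have n02 : ord0 != ord_max :> 'I_3 by [].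
have n12 : i1 != ord_max by [].
have [p [q [r [[ep eq er perC]|[ep eq er perC]]]]] :=
  rot_split3 cC uC (xC ord0) (xC i1) (xC ord_max) (xdis _ _ n01) (xdis _ _ n02) (xdis _ _ n12).
  exact: core n01 n02 n12 ep eq er perC.
by apply: core n02 n01 _ ep eq er perC; rewrite eq_sym.
Qed.

End Patterns.

Section Strong.
Variable T : finType.
Implicit Types (e r : rel T) (A B N Y S : {set T}) (a u v x y z w : T) (C : seq T).

Lemma critical_exists A e : ~ colorable A e -> exists2 B : {set T}, B \subset A & critical B e.
Proof.
have [n] := ubnP #|A|; elim: n A => // n IH A; rewrite ltnS => leA nA.
have [[v Av nv]|crit] := pselect (exists2 v, v \in A & ~ colorable (A :\ v) e).
  have [|B BA cB] := IH (A :\ v) _ nv.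
    by apply: leq_trans leA; rewrite [ltnRHS](cardsD1 v) Av.
  by exists B => //; apply: subset_trans BA (subsetDl _ _).
exists A => //; split=> // v Av; apply: contrapT => nv; apply: crit; by exists v.
Qed.

(** Otherwise the set reached from [x] and the rest are colourable separately. No arc leaves the
    reached set, so raising its ranks above all others combines the colourings. *)
Lemma critical_connect A e x y : critical A e -> x \in A -> y \in A ->
  connect (restr A e) x y.
Proof.
move=> crA Ax Ay; apply: contraT => nxy.
pose R := [set v in A | connect (restr A e) x v].
have Rx : x \in R by rewrite inE Ax connect0.
have [c1 [f1 cf1]] : colorable (A :\: R) e.
  apply: critical_proper crA _; apply/properP; split; first exact: subsetDl.
  by exists x; rewrite // in_setD Rx.
have [c2 [f2 cf2]] : colorable R e.
  apply: critical_proper crA _; apply/properP; split.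
    by apply/subsetP => v /setIdP[].
  by exists y; rewrite // inE (negPf nxy) andbF.
case: crA => nA _; case: nA.
exists (fun v => if v \in R then c2 v else c1 v),
  (fun v => if v \in R then f2 v + (\max_t f1 t).+1 else f1 v) => u v Au Av euv.
have closed : u \in R -> v \in R.
  move=> /setIdP[_ cu]; rewrite inE Av /=; apply: connect_trans cu _.
  by apply: connect1; apply/and3P.
case: ifPn => Ru; case: ifPn => Rv.
- by move=> E; rewrite ltn_add2r; apply: cf2.
- by rewrite closed in Rv.
- by have := leq_bigmax (F := f1) u; clear; lia.
by move=> E; apply: cf1; rewrite // in_setD ?Ru ?Rv.
Qed.

Lemma strong_embeds A e C w : critical A e -> wheel_at A e C w -> embeds pat_strong e.
Proof.
move=> crA W; have [[cC uC sC CA wA] [nwC _]] := W.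
have [x [s [xC es _ sO dis]]] := wheel_paths W.
pose O := A :\: [set t in C].
have Ow : w \in O by rewrite in_setD inE nwC.
have OC t : t \in O -> t \notin C by rewrite in_setD inE => /andP[].
have toW i : exists2 o, e (x i) o & (o \in O) && connect (restr O e) o w.
  have sOi t : t \in rcons (s i) w -> t \in O.
    by rewrite mem_rcons inE => /orP[/eqP->//|/sO[At _ nt]]; rewrite in_setD inE nt.
  have := es i; have := sOi; case: (s i) => [|o q] sq /=.
    by rewrite andbT => exw; exists w; rewrite ?Ow ?connect0.
  case/andP=> exo eq; have Oo : o \in O by rewrite sq // mem_head.
  exists o => //; rewrite Oo /=; apply/connectP; exists (rcons q w); rewrite ?last_rcons //.
  by apply: path_restrI eq => // t qt; rewrite sq // rcons_cons inE qt orbT.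
have [u [v [Cu Ov cwv evu]]] : exists u v,
    [/\ u \in C, v \in O, connect (restr O e) w v & e v u].
  have Cx : x ord0 \in [set t in C] by rewrite inE.
  have cwx := critical_connect crA wA (CA _ (xC ord0)).
  have [p [rp _ lp nb]] := first_hit cwx Cx.
  case: (lastP p) rp lp nb => [|q u] rp; first by rewrite inE /= (negPf nwC).
  rewrite last_rcons inE belast_rcons => Cu nq.
  have [eq sq] := path_restr rp; move: eq; rewrite rcons_path => /andP[eq evu].
  have qO t : t \in w :: q -> t \in O.
    move=> qt; rewrite in_setD nq //=; move: qt; rewrite inE => /orP[/eqP->//|qt].
    by apply: sq; rewrite mem_rcons inE qt orbT.
  exists u, (last w q); split=> //; first by apply: qO; apply: mem_last.
  apply/connectP; exists q => //; apply: path_restrI eq => // t qt.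
  by apply: qO; rewrite inE qt orbT.
have core y z p q (r : seq T) : y \in C -> z \in C ->
    (exists2 o, e y o & (o \in O) && connect (restr O e) o w) ->
    (exists2 o, e z o & (o \in O) && connect (restr O e) o w) ->
    path e u (rcons p y) -> path e y (rcons q z) -> path e z (rcons r u) ->
    perm_eq (u :: p ++ y :: q ++ z :: r) C -> embeds pat_strong e.
  move=> Cy Cz [oy eyo /andP[Oy cyw]] [oz ezo /andP[Oz czw]] ep eq er perC.
  case/connectP: cwv => Q0 /shortenP[Q rQ uQ _ Ev] {Q0}.
  have Sw : w \in [set t in w :: Q] by rewrite inE mem_head.
  have [p1 [rp1 up1 lp1 nb1]] := first_hit czw Sw.
  have [eQ sQ] := path_restr rQ; have [ep1 sp1] := path_restr rp1.
  move: lp1; rewrite inE => lp1; set h := last oz p1 in lp1.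
  have [Q1 [Q2 EQ]] : exists Q1 Q2, w :: Q = Q1 ++ h :: Q2.
    by case/splitPr: lp1 => Q1 Q2; exists Q1, Q2.
  have [cwh eQ2 lQ2] : [/\ connect (restr O e) w h, path e h Q2 & last h Q2 = v].
    move: rQ eQ Ev; case: Q1 EQ => [[<- ->]|w1 Q1 [_ ->]] //.
    rewrite !cat_path last_cat /= => /and3P[rQ1 rh _] /and3P[_ _ ->] ->.
    split=> //; apply: (@connect_trans _ _ (last w Q1)).
      by apply/connectP; exists Q1.
    exact: connect1.
  have uhQ2 : uniq (h :: Q2) by move: uQ; rewrite EQ cat_uniq => /and3P[].
  have QO t : t \in w :: Q -> t \in O by rewrite inE => /orP[/eqP->|/sQ].
  (* The path from [z] towards [w] is followed to its first vertex [h] on [Q], and then [Q] to [v]: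
     the interior of a path from [z] to [u] off [C]. *)
  pose R := oz :: p1 ++ Q2.
  have RO t : t \in R -> t \in O.
    rewrite inE mem_cat => /or3P[/eqP->//|/sp1//|Q2t].
    by apply: QO; rewrite EQ mem_cat inE Q2t !orbT.
  have eR : path e z (rcons R u).
    rewrite rcons_path /R -cat_cons cat_path last_cat /= ezo ep1.
    by rewrite -/h eQ2 lQ2 evu.
  have uR : uniq R.
    rewrite /R -cat_cons; apply: uniq_cat_disj => //.
      by case/andP: uhQ2.
    move=> t; rewrite lastI mem_rcons inE -/h => /orP[/eqP->|/nb1].
      by case/andP: uhQ2.
    by rewrite inE EQ mem_cat inE !negb_or => /and3P[].
  have Rh : h \in [set t in R] by rewrite inE /R -cat_cons mem_cat mem_last.
  (* The path from [y] continues through [w] to [h], which lies on [R], so it has a first vertex [c]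
     on [R]. *)
  have [p2 [rp2 up2 lp2 nb2]] := first_hit (connect_trans cyw cwh) Rh.
  have [ep2 sp2] := path_restr rp2; move: lp2; rewrite inE => lp2.
  pose I := belast oy p2; set c := last oy p2 in lp2.
  have EI : oy :: p2 = rcons I c by apply: lastI.
  have [R1 [R2 ER]] : exists R1 R2, R = R1 ++ c :: R2.
    by case/splitPr: lp2 => R1 R2; exists R1, R2.
  have eI : path e y (rcons I c) by rewrite -EI /= eyo.
  have IO t : t \in I -> t \in O.
    move=> It; have : t \in oy :: p2 by rewrite EI mem_rcons inE It orbT.
    by rewrite inE => /orP[/eqP->|/sp2].
  have U : uniq (C ++ R ++ I).
    apply: uniq_cat_disj => // [|t Ct]; last first.
      rewrite mem_cat negb_or; apply/andP; split; apply: contraL Ct;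
        by [move/RO/OC | move/IO/OC].
    apply: uniq_cat_disj => // [|t Rt].
      by move: up2; rewrite EI rcons_uniq => /andP[].
    by apply: contraL Rt => /nb2; rewrite inE.
  (* The 4-cycle runs from [y] along [C] to [z], along [R] through [c] to [u], and along [C] back to
     [y]. The chords are [I] from [y] to [c] and the arc [r] of [C] from [z] to [u]. *)
  exists y, [:: y; z; c; u], [:: q; R1; R2; p; I; r]; split=> //.
    rewrite -(perm_uniq (_ : perm_eq (C ++ R ++ I) _)) //.
    apply/seq.permP => a; have /seq.permP/(_ a) := perC; rewrite ER.
    by rewrite /= !(count_cat, cats0) /= !(count_cat, cats0) /=; clear; lia.
  move: eR; rewrite ER rcons_cat rcons_cons -cat_rcons cat_path last_rcons => /andP[eR1 eR2].
  by rewrite /= eq eR1 eR2 ep eI er.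
(* The three starting points on [C] are distinct, so at most one of them is [u]. *)
have [i [j [nij niu nju]]] : exists i j, [/\ i != j, x i != u & x j != u].
  have xinj i j : x i = u -> x j = u -> i = j.
    by move=> Ei Ej; apply: (dis i j u); rewrite -?Ei ?Ej ?mem_head // Ei -Ej mem_head.
  pose i1 : 'I_3 := lift ord0 ord0.
  have [E0|n0] := eqVneq (x ord0) u.
    exists i1, ord_max; split=> //; apply/eqP => E;
      by have := xinj _ _ E0 E.
  have [E1|n1] := eqVneq (x i1) u; last by exists ord0, i1.
  by exists ord0, ord_max; split=> //; apply/eqP => E; have := xinj _ _ E1 E.
have nxij : x i != x j.
  by apply: contra nij => /eqP E; rewrite (dis i j (x i)) ?E ?mem_head.
rewrite eq_sym in niu; rewrite eq_sym in nju.
have [p [q [r [[ep eq er perC]|[ep eq er perC]]]]] :=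
  rot_split3 cC uC Cu (xC i) (xC j) niu nju nxij.
  exact: (core _ _ _ _ _ (xC i) (xC j) (toW i) (toW j) ep eq er perC).
exact: (core _ _ _ _ _ (xC j) (xC i) (toW j) (toW i) ep eq er perC).
Qed.
End Strong.

(** * Tournaments of order 4 *)

Lemma colorable_acyclic (D : digraph) :
  colorable [set: D] (@Defs.arc D) -> acyclic_colorable D 3.
Proof.
case=> c [f cf]; exists c => i [//|x q] sub_p /andP[cyc _]; exfalso.
have : path (relpre f ltn) x (rcons q x).
  have qP u : u \in x :: rcons q x -> c u = i.
    move=> qu; have : u \in x :: q by move: qu; rewrite inE mem_rcons => /predU1P[->|//]; rewrite mem_head.
    by move/sub_p; rewrite !inE => /eqP.
  have {cyc} : path (@Defs.arc D) x (rcons q x) by exact: cyc.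
  move: (rcons q x) qP => s sP {sub_p} cyc.
  elim: s x cyc sP => //= v s IH x /andP[xv es] sP.
  rewrite IH // ?andbT => [|u su]; last by apply: sP; rewrite inE su orbT.
  by apply: cf; rewrite ?inE // !sP // !inE eqxx ?orbT.
move/order_path_min => min; have /allP/(_ x) := min (fun _ _ _ => @ltn_trans _ _ _).
by rewrite mem_rcons mem_head /= ltnn => /(_ isT).
Qed.

Lemma dichromatic_noncolorable (D : digraph) :
  4 <= dichromatic D -> ~ colorable [set: D] (@Defs.arc D).
Proof.
move=> ge4 /colorable_acyclic col; have [|_ min] := @leastP (acyclic_colorable D).
  by exists 3.
by have := leq_trans ge4 (min 3 col).
Qed.

Lemma pattern_embeds (D : digraph) pat : 4 <= dichromatic D ->
  pat \in [:: pat_trans; pat_sink; pat_source; pat_strong] ->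
  embeds pat (@Defs.arc D).
Proof.
move/dichromatic_noncolorable => nD.
have ie : irreflexive (@Defs.arc D) by apply: arc_irr.
have ie' : irreflexive (conv (@Defs.arc D)) by move=> x; apply: arc_irr.
have nD' : ~ colorable [set: D] (conv (@Defs.arc D)) by move/colorable_conv.
rewrite !inE => /or4P[] /eqP->.
- have /card_gt0P[z _] := vertex_gt0 D.
  have [[a [w [th _]]] _] := theta_of_noncolorable z ie nD.
  exact: theta_embeds th.
- have [C [w W]] := wheel_of_noncolorable ie nD; exact: sink_embeds W.
- have [C [w W]] := wheel_of_noncolorable ie' nD'.
  exact: (embeds_conv (sink_embeds W)).
have [B _ crB] := critical_exists nD.
have [C [w W]] := wheel_of_noncolorable ie crB.1.
exact: strong_embeds crB W.
Qed.

Definition tournament4 (b01 b02 b03 b12 b13 b23 : bool) (i j : nat) : bool :=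
  match i, j with
  | 0, 1 => b01 | 0, 2 => b02 | 0, 3 => b03
  | 1, 2 => b12 | 1, 3 => b13 | 2, 3 => b23
  | 1, 0 => ~~ b01 | 2, 0 => ~~ b02 | 3, 0 => ~~ b03
  | 2, 1 => ~~ b12 | 3, 1 => ~~ b13 | 3, 2 => ~~ b23
  | _, _ => false
  end.

(** All 64 labelled tournaments are checked by computation; [s] sends the vertices of the pattern to
    those of the tournament. *)
Lemma tournament4_pattern b01 b02 b03 b12 b13 b23 :
  has (fun pat => has (fun s =>
    all (fun i => all (fun j =>
      tournament4 b01 b02 b03 b12 b13 b23 (nth 0 s i) (nth 0 s j)
        == ((i, j) \in pat)) (iota 0 4)) (iota 0 4))
    (permutations (iota 0 4)))
  [:: pat_trans; pat_sink; pat_source; pat_strong].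
Proof. by case: b01; case: b02; case: b03; case: b12; case: b13; case: b23; vm_compute. Qed.

Lemma tournament_pattern (K : digraph) : #|K| = 4 ->
  is_orientation (@complete_rel K) ->
  exists2 pat, pat \in [:: pat_trans; pat_sink; pat_source; pat_strong] &
    exists vs : seq K, [/\ size vs = 4, forall x : K, x \in vs &
      forall x y : K, Defs.arc x y = ((index x vs, index y vs) \in pat)].
Proof.
move=> cardK orK.
have arcN (x y : K) : x != y -> Defs.arc y x = ~~ Defs.arc x y.
  move=> nxy; have [+ /negP] := orK x y; rewrite /complete_rel nxy.
  by case: (Defs.arc x y); case: (Defs.arc y x).
have size_enum : size (enum K) = 4 by rewrite -cardE.
case E: (enum K) size_enum => [|a [|b [|c [|d []]]]] // _.
have uE : uniq [:: a; b; c; d] by rewrite -E enum_uniq.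
have memE (x : K) : x \in [:: a; b; c; d] by rewrite -E mem_enum.
pose M := tournament4 (Defs.arc a b) (Defs.arc a c) (Defs.arc a d)
                      (Defs.arc b c) (Defs.arc b d) (Defs.arc c d).
have arcM i j : i < 4 -> j < 4 ->
    Defs.arc (nth a [:: a; b; c; d] i) (nth a [:: a; b; c; d] j) = M i j.
  have ne k l : k < l < 4 -> nth a [:: a; b; c; d] k != nth a [:: a; b; c; d] l.
    by move=> /andP[ltkl lt4]; rewrite nth_uniq // ?ltn_eqF //; apply: ltn_trans lt4.
  by case: i => [|[|[|[|]]]] //; case: j => [|[|[|[|]]]] // _ _;
    rewrite /M /= ?arc_irr // arcN //;
    [exact: (ne 0 1) | exact: (ne 0 2) | exact: (ne 1 2)
    | exact: (ne 0 3) | exact: (ne 1 3) | exact: (ne 2 3)].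
have /hasP[pat patP /hasP[s]] := tournament4_pattern (Defs.arc a b) (Defs.arc a c)
  (Defs.arc a d) (Defs.arc b c) (Defs.arc b d) (Defs.arc c d).
rewrite mem_permutations => perm_s /allP chk; exists pat => //.
have size_s : size s = 4 by rewrite (perm_size perm_s).
have lts i : i < 4 -> nth 0 s i < 4.
  move=> lti; have : nth 0 s i \in iota 0 4 by rewrite -(perm_mem perm_s) mem_nth ?size_s.
  by rewrite mem_iota.
exists [seq nth a [:: a; b; c; d] i | i <- s].
have memv (x : K) : x \in [seq nth a [:: a; b; c; d] i | i <- s].
  have idx : index x [:: a; b; c; d] < 4 by rewrite index_mem.
  apply/mapP; exists (index x [:: a; b; c; d]); last by rewrite nth_index.
  by rewrite (perm_mem perm_s) mem_iota.
split=> //; first by rewrite size_map.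
move=> x y; set vs := map _ s in memv *.
have lt_i (z : K) : index z vs < 4 by rewrite -size_s -(size_map (nth a [:: a; b; c; d])) index_mem.
have Ez (z : K) : z = nth a [:: a; b; c; d] (nth 0 s (index z vs)).
  by rewrite -(nth_map 0 a) ?size_s // nth_index.
rewrite {1}(Ez x) {1}(Ez y) arcM ?lts //.
have i4 z : index z vs \in iota 0 4 by rewrite mem_iota lt_i.
by have /allP/(_ _ (i4 y))/eqP := chk _ (i4 x).
Qed.

(** * Sharpness of the bound *)

Definition bitriangle : digraph :=
  @Digraph 'I_3 (fun x y => x != y) (fun x => negbF (eqxx x)) (ltac:(by rewrite card_ord)).

(** Two vertices of the same colour would form a monochromatic digon, so acyclic colourings are
    injective. *)
Lemma bitriangle_dichromatic : 3 <= dichromatic bitriangle.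
Proof.
have [|[c cP] _] := @leastP (acyclic_colorable bitriangle).
  by exists #|bitriangle|; apply: acyclic_colorable_card.
suff injc : injective c by have := leq_card c injc; rewrite !card_ord.
move=> x y cxy; apply/eqP; apply: contraT => nxy.
have := cP (c x) [:: x; y]; rewrite /ucycle /= !andbT inE nxy eq_sym nxy => H.
by have : [:: x; y] = [::] by [apply: H => // z; rewrite !inE => /orP[]/eqP->; rewrite -?cxy].
Qed.

Lemma small_no_subdivision (D K : digraph) : #|D| < #|K| -> ~ contains_subdivision D K.
Proof.
move=> ltDK [l [S [f [bij_f _]]]]; move: ltDK; rewrite ltnNge => /negP; apply.
have := bij_eq_card bij_f; rewrite card_sig card_sum => E.
by apply: leq_trans (leq_trans (leq_addr _ _) (_ : _ <= #|sub_vertex S|)) (max_card _); rewrite E.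
Qed.

Theorem theorem11 (K : digraph) (cardK : #|K| = 4)
  (orK : is_orientation (@complete_rel K)) : mader K = 4.
Proof.
pose P k := 1 <= k /\ forall D : digraph, k <= dichromatic D -> contains_subdivision D K.
have P4 : P 4.
  split=> // D ge4; have [pat patP [vs [svs vsP arcE]]] := tournament_pattern cardK orK.
  exact: embeds_contains svs vsP arcE (pattern_embeds ge4 patP).
have [|[_ Pm] min] := @leastP P; first by exists 4.
apply/eqP; rewrite eqn_leq min //= leqNgt; apply/negP => lt4.
apply: (@small_no_subdivision bitriangle K); first by rewrite card_ord cardK.
by apply: Pm; apply: leq_trans bitriangle_dichromatic.
Qed.
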